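(* Let $\rho$ be a probability measure on $\mathbb{R}^D$ supported on $\mathcal{M}$, let $\mathcal{T}=\{C_{j,k}\}$ be a multiscale tree decomposition of $\mathcal M$ satisfying (A1)-(A5), and let $x_1,\dots,x_n$ ($n\ge2$) be i.i.d. samples from $\rho$, independent of $\mathcal T$. Suppose $\rho\in\mathcal{A}_s$ for some $s\ge1$. Let $\nu>0$ be arbitrary and $\mu>0$. Let the scale $j^*$ be chosen such that $$2^{-j^*}=\begin{cases}\mu\,\frac{\log n}{n}, & d=1,\\[2pt] \mu\left(\frac{\log n}{n}\right)^{\frac1{2s+d-2}}, & d\ge2.\end{cases}$$ Then there exist $C_1=C_1(\theta_1,\theta_2,\theta_3,\theta_4,d,\nu,\mu)$ and $C_2=C_2(\theta_1,\theta_2,\theta_3,\theta_4,d,\mu)$ such that $$\mathbb{P}\left\{\|X-\widehat{\mathcal{P}}_{j^*}X\|\ge(|\rho|_{\mathcal{A}_s}\mu^s+C_1)\frac{\log n}{n}\right\}\le C_2n^{-\nu}\quad\text{for }d=1,$$ $$\mathbb{P}\left\{\|X-\widehat{\mathcal{P}}_{j^*}X\|\ge(|\rho|_{\mathcal{A}_s}\mu^s+C_1)\left(\frac{\log n}{n}\right)^{\frac{s}{2s+d-2}}\right\}\le C_2n^{-\nu}\quad\text{for }d\ge2.$$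
   Context: Basic notation. $1\le d\le D$ are integers, $\rho$ is a Borel probability measure on $\mathbb{R}^D$ supported on $\mathcal{M}\subset\mathbb R^D$, $X\sim\rho$. For a map $\mathcal{P}:\mathcal{M}\to\mathbb{R}^D$, $\|\mathcal{P}X\|:=(\int_{\mathcal{M}}\|\mathcal{P}x\|^2d\rho(x))^{1/2}$ and $\|X-\mathcal{P}X\|$ is understood likewise; if $\mathcal P$ depends on the samples this is a random variable. $\mathrm{Proj}_V$ is orthogonal projection onto the subspace $V$. $\rho|_{C}$ is the conditional distribution of $\rho$ on $C$. Multiscale tree decomposition. Fix constants $\theta_1,\theta_2,\theta_3>0$, $\theta_4\in(0,1)$, $a_{\min},a_{\max}$ (the same for all decompositions considered). A multiscale tree decomposition $\mathcal{T}$ is a family of sets (cells) $\{C_{j,k}\}_{k\in\mathcal{K}_j,\,j\ge j_{\min}}$, with a single root cell at scale $j_{\min}$, such that for all integers $j\ge j_{\min}$: (A1) for $k\in\mathcal{K}_j$, $k'\in\mathcal{K}_{j+1}$ either $C_{j+1,k'}\subseteq C_{j,k}$ ($C_{j+1,k'}$ is then a child of $C_{j,k}$) or $\rho(C_{j+1,k'}\cap C_{j,k})=0$; each cell has at least $a_{\min}$ and at most $a_{\max}$ children; each $C_{j,k}$ with $j>j_{\min}$ is contained in a unique $C_{j-1,k'}$, its parent. (A2) $\rho(\mathcal{M}\setminus\bigcup_{k\in\mathcal{K}_j}C_{j,k})=0$. (A3) $\#\mathcal K_j\le 2^{jd}/\theta_1$. (A4) if $x\sim\rho|_{C_{j,k}}$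 then a.s. $\|x-c_{j,k}\|\le\theta_2 2^{-j}$. (A5) the eigenvalues $\lambda_1^{j,k}\ge\dots\ge\lambda_D^{j,k}$ of $\Sigma_{j,k}$ satisfy $\lambda_d^{j,k}\ge\theta_3 2^{-2j}/d$ and $\lambda_{d+1}^{j,k}\le\theta_4\lambda_d^{j,k}$. Here $c_{j,k}$ and $\Sigma_{j,k}$ are the mean and covariance matrix of $\rho|_{C_{j,k}}$. Let $V_{j,k}$ be the span of the eigenvectors of the $d$ largest eigenvalues of $\Sigma_{j,k}$, $\mathcal{P}_{j,k}(x)=c_{j,k}+\mathrm{Proj}_{V_{j,k}}(x-c_{j,k})$, $\mathbf{1}_{j,k}$ the indicator function of $C_{j,k}$, $\mathcal{P}_j=\sum_{k\in\mathcal{K}_j}\mathcal{P}_{j,k}\mathbf{1}_{j,k}$. Model class $\mathcal{A}_s$: $\rho\in\mathcal{A}_s$ if $|\rho|_{\mathcal{A}_s}:=\sup_{\mathcal{T}}\inf\{A_0:\|X-\mathcal{P}_jX\|\le A_02^{-js}\ \forall j\ge j_{\min}\}<\infty$, where $\mathcal{T}$ ranges over the (assumed nonempty) set of multiscale tree decompositions satisfying (A1)-(A5). Empirical GMRA. Let $\hat n_{j,k}$ be the number of samples in $C_{j,k}$, $\hat c_{j,k}$ the average of the samples in $C_{j,k}$, $\hat\Sigma_{j,k}=\frac1{\hat n_{j,k}}\sum_{x_i\in C_{j,k}}(x_i-\hat c_{j,k})(x_i-\hat c_{j,k})^T$, $\hat V_{j,k}$ the span of eigenvectors of the $d$ largest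 eigenvalues of $\hat\Sigma_{j,k}$, $\widehat{\mathcal{P}}_{j,k}(x)=\hat c_{j,k}+\mathrm{Proj}_{\hat V_{j,k}}(x-\hat c_{j,k})$, $\widehat{\mathcal{P}}_j=\sum_{k\in\mathcal K_j}\widehat{\mathcal{P}}_{j,k}\mathbf{1}_{j,k}$. (If a cell has no samples, $\hat c_{j,k}$ is any fixed point of the cell with $\|\hat c_{j,k}-c_{j,k}\|\le\theta_22^{-j}$ and $\hat V_{j,k}$ any $d$-dimensional subspace; eigenvector ties are broken arbitrarily.) The scale $j^*$ is understood to be an integer with $j^*\ge j_{\min}$. *)

(* Defs.v *)
From HB Require Import structures.
From mathcomp Require Export all_boot all_order all_algebra.
From mathcomp Require Export all_classical all_reals all_analysis.
Export Order.TTheory GRing.Theory Num.Theory.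
Export numFieldNormedType.Exports.

Set Implicit Arguments.
Unset Strict Implicit.
Unset Printing Implicit Defensive.

Local Open Scope classical_set_scope.
Local Open Scope ring_scope.

(* R^D is the space of row vectors; its topology is the product topology. *)
Notation borelV R D := (g_sigma_algebraType (@open 'rV[R]_D)).

(* The library norm [`|x|] on row vectors is the sup norm. *)
Definition enorm (R : realType) (D : nat) (x : 'rV[R]_D) : R :=
  Num.sqrt (\sum_(i < D) x ord0 i ^+ 2).

(* Orthogonal projection onto the row space of V: the kernel of V^T is the
   orthogonal complement of that space. *)
Definition orthproj (R : realType) (d D : nat) (V : 'M[R]_(d, D))
    (x : 'rV[R]_D) : 'rV[R]_D :=
  x *m proj_mx <<V>>%MS (kermx V^T).

Definition affproj (R : realType) (d D : nat) (c : 'rV[R]_D)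
    (V : 'M[R]_(d, D)) (x : 'rV[R]_D) : 'rV[R]_D :=
  c + orthproj V (x - c).

(* The eigenvalues of A with multiplicity, in nonincreasing order.  For a
   symmetric A exactly one sequence satisfies the predicate.  The k-th largest
   eigenvalue is [(eigvals A)`_(k.-1)]; for k > D it is 0, which fixes the
   convention lambda_(D+1) = 0. *)
Definition eigvals (R : realType) (D : nat) (A : 'M[R]_D) : seq R :=
  xget [::] [set lam : seq R | sorted >=%R lam /\
    char_poly A = \prod_(a <- lam) ('X - a%:P)].

(* The rows of V are d linearly independent eigenvectors for the d largest
   eigenvalues.  If the d-th eigenvalue equals the next one, the row space of
   V is not determined by A. *)
Definition top_eigenvectors (R : realType) (d D : nat) (A : 'M[R]_D)
    (V : 'M[R]_(d, D)) : Prop :=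
  row_free V /\
  forall i : 'I_d, row i V *m A = (eigvals A)`_i *: row i V.

Definition cond_mean (R : realType) (D : nat)
    (rho : probability (borelV R D) R) (C : set 'rV[R]_D) : 'rV[R]_D :=
  (fine (rho C))^-1 *: \row_i (\int[rho]_(x in C) (x : 'rV[R]_D) ord0 i)%R.

Definition cond_cov (R : realType) (D : nat)
    (rho : probability (borelV R D) R) (C : set 'rV[R]_D) : 'M[R]_D :=
  let c := cond_mean rho C in
  (fine (rho C))^-1 *: \matrix_(i, j)
    (\int[rho]_(x in C) (((x : 'rV[R]_D) - c) ord0 i *
                         ((x : 'rV[R]_D) - c) ord0 j))%R.

(* Under axA5 the d-th spectral gap is positive, so the row space of this
   matrix does not depend on the choice. *)
Definition cond_topspace (R : realType) (d D : nat)
    (rho : probability (borelV R D) R) (C : set 'rV[R]_D) : 'M[R]_(d, D) :=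
  xget 0 [set V : 'M[R]_(d, D) | top_eigenvectors (cond_cov rho C) V].

(* Only the scales j >= jmin are meaningful. *)
Record cell_family (R : realType) (D : nat) := CellFamily {
  jmin : int;
  ncells : int -> nat;
  cell : forall j : int, 'I_(ncells j) -> set 'rV[R]_D }.

(* The conjunct 0 < rho C makes the conditional law on the cell C meaningful;
   axA5 forces it anyway. *)
Definition cells_wf (R : realType) (D : nat)
    (rho : probability (borelV R D) R) (M : set 'rV[R]_D)
    (T : cell_family R D) : Prop :=
  ncells T (jmin T) = 1%N /\
  forall (j : int) (k : 'I_(ncells T j)), jmin T <= j ->
    [/\ measurable (cell k : set (borelV R D)),
        cell k `<=` M & (0 < rho (cell k))%E].

Definition axA1 (R : realType) (D : nat) (amin amax : nat)
    (rho : probability (borelV R D) R) (T : cell_family R D) : Prop :=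
  forall j : int, jmin T <= j ->
  [/\ forall (k : 'I_(ncells T j)) (k' : 'I_(ncells T (j + 1))),
        cell k' `<=` cell k \/ rho (cell k' `&` cell k) = 0%E,
      forall k : 'I_(ncells T j),
        (amin <= #|[set k' : 'I_(ncells T (j + 1)) |
                     `[< cell k' `<=` cell k >]]%SET| <= amax)%N
    & forall k' : 'I_(ncells T (j + 1)),
        exists! k : 'I_(ncells T j), cell k' `<=` cell k].

Definition axA2 (R : realType) (D : nat)
    (rho : probability (borelV R D) R) (M : set 'rV[R]_D)
    (T : cell_family R D) : Prop :=
  forall j : int, jmin T <= j ->
  rho (M `\` \bigcup_(k in [set: 'I_(ncells T j)]) cell k) = 0%E.

Definition axA3 (R : realType) (D d : nat) (theta1 : R)
    (T : cell_family R D) : Prop :=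
  forall j : int, jmin T <= j ->
  (ncells T j)%:R <= 2 ^ (j * d%:Z) / theta1.

Definition axA4 (R : realType) (D : nat) (theta2 : R)
    (rho : probability (borelV R D) R) (T : cell_family R D) : Prop :=
  forall (j : int) (k : 'I_(ncells T j)), jmin T <= j ->
  {ae rho, forall x, cell k x ->
    enorm ((x : 'rV[R]_D) - cond_mean rho (cell k)) <= theta2 * 2 ^ (- j)}.

Definition axA5 (R : realType) (D d : nat) (theta3 theta4 : R)
    (rho : probability (borelV R D) R) (T : cell_family R D) : Prop :=
  forall (j : int) (k : 'I_(ncells T j)), jmin T <= j ->
  let lam := eigvals (cond_cov rho (cell k)) in
  theta3 * 2 ^ (- (2 * j)) / d%:R <= lam`_(d.-1) /\
  lam`_d <= theta4 * lam`_(d.-1).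

Definition multiscale_tree (R : realType) (D d : nat)
    (theta1 theta2 theta3 theta4 : R) (amin amax : nat)
    (rho : probability (borelV R D) R) (M : set 'rV[R]_D)
    (T : cell_family R D) : Prop :=
  cells_wf rho M T /\
  [/\ axA1 amin amax rho T, axA2 rho M T, axA3 d theta1 T,
      axA4 theta2 rho T & axA5 d theta3 theta4 rho T].

Definition piecewise_affproj (R : realType) (D d : nat) (T : cell_family R D)
    (j : int) (c : 'I_(ncells T j) -> 'rV[R]_D)
    (V : 'I_(ncells T j) -> 'M[R]_(d, D)) (x : 'rV[R]_D) : 'rV[R]_D :=
  \sum_(k < ncells T j) \1_(cell k) x *: affproj (c k) (V k) x.

Definition gmra_proj (R : realType) (D d : nat)
    (rho : probability (borelV R D) R) (T : cell_family R D) (j : int) :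
    'rV[R]_D -> 'rV[R]_D :=
  piecewise_affproj (fun k : 'I_(ncells T j) => cond_mean rho (cell k))
                    (fun k => cond_topspace d rho (cell k)).

Definition L2err (R : realType) (D : nat)
    (rho : probability (borelV R D) R) (M : set 'rV[R]_D)
    (Q : 'rV[R]_D -> 'rV[R]_D) : \bar R :=
  ((\int[rho]_(x in M) (enorm ((x : 'rV[R]_D) - Q x) ^+ 2)%:E) `^ 2^-1)%E.

(* |rho|_{A_s}, as an extended real; rho is in A_s iff it is < +oo. *)
Definition As_norm (R : realType) (D d : nat)
    (theta1 theta2 theta3 theta4 : R) (amin amax : nat) (s : R)
    (rho : probability (borelV R D) R) (M : set 'rV[R]_D) : \bar R :=
  ereal_sup [set ereal_inf [set A0%:E | A0 in [set A0 : R |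
      forall j : int, jmin T <= j ->
        (L2err rho M (gmra_proj d rho T j) <=
          (A0 * 2 `^ (- (j%:~R * s)))%:E)%E]]
    | T in [set T : cell_family R D |
        multiscale_tree d theta1 theta2 theta3 theta4 amin amax rho M T]].

(* Taking some of the B i to be the full space gives the product rule for all
   subfamilies. *)
Definition iid_samples (R : realType) (D n : nat)
    (dO : measure_display) (Omega : measurableType dO)
    (P : probability Omega R) (rho : probability (borelV R D) R)
    (X : 'I_n -> {RV P >-> borelV R D}) : Prop :=
  (forall (i : 'I_n) (B : set (borelV R D)), measurable B ->
     distribution P (X i) B = rho B) /\
  (forall B : 'I_n -> set (borelV R D), (forall i, measurable (B i)) ->
     P (\bigcap_(i in [set: 'I_n]) (X i @^-1` B i)) =
       (\prod_(i < n) P (X i @^-1` B i))%E).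

Definition emp_count (R : realType) (D n : nat) (x : 'I_n -> 'rV[R]_D)
    (C : set 'rV[R]_D) : nat :=
  #|[set i : 'I_n | x i \in C]%SET|.

(* c0 is the value used when no sample falls in C. *)
Definition emp_mean (R : realType) (D n : nat) (x : 'I_n -> 'rV[R]_D)
    (C : set 'rV[R]_D) (c0 : 'rV[R]_D) : 'rV[R]_D :=
  if emp_count x C == 0%N then c0
  else (emp_count x C)%:R^-1 *: \sum_(i < n | x i \in C) x i.

Definition emp_cov (R : realType) (D n : nat) (x : 'I_n -> 'rV[R]_D)
    (C : set 'rV[R]_D) (c0 : 'rV[R]_D) : 'M[R]_D :=
  let c := emp_mean x C c0 in
  (emp_count x C)%:R^-1 *:
    \sum_(i < n | x i \in C) (x i - c)^T *m (x i - c).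

(* Row spaces of such V are the admissible values of the empirical subspace:
   ties are unconstrained, and so is the subspace of an empty cell. *)
Definition emp_topspace (R : realType) (D d n : nat) (x : 'I_n -> 'rV[R]_D)
    (C : set 'rV[R]_D) (c0 : 'rV[R]_D) (V : 'M[R]_(d, D)) : Prop :=
  if emp_count x C == 0%N then (row_free V : Prop)
  else top_eigenvectors (emp_cov x C c0) V.

Definition emp_gmra_proj (R : realType) (D d n : nat) (T : cell_family R D)
    (j : int) (x : 'I_n -> 'rV[R]_D) (c0 : 'I_(ncells T j) -> 'rV[R]_D)
    (V : 'I_(ncells T j) -> 'M[R]_(d, D)) : 'rV[R]_D -> 'rV[R]_D :=
  piecewise_affproj (fun k => emp_mean x (cell k) (c0 k)) V.

Definition scale_rate (R : realType) (d n : nat) (s : R) : R :=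
  if d == 1%N then ln n%:R / n%:R
  else (ln n%:R / n%:R) `^ (2 * s + d%:R - 2)^-1.

Definition error_rate (R : realType) (d n : nat) (s : R) : R :=
  if d == 1%N then ln n%:R / n%:R
  else (ln n%:R / n%:R) `^ (s / (2 * s + d%:R - 2)).

(* Main.v *)
From HB Require Import structures.
Require Import Defs.
From mathcomp Require Import complex measurable_realfun ring lra zify.

Set Implicit Arguments.
Unset Strict Implicit.
Unset Printing Implicit Defensive.

Local Open Scope classical_set_scope.
Local Open Scope ring_scope.

(** Bias and variance are separated. Minkowski's inequality bounds the $L^2$ error of the empirical
    projection by that of [gmra_proj], which the model class controls by a multiple of $2^{-js}$,
    plus the $L^2$ distance of the two piecewise projections. Cells of one scale overlap only in
    null sets ([same_scale_disjoint]), so the square of this distance is at most a sum over cells of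
    mass times squared uniform error ([integral_cells_le]).

    Consider a cell of radius $r=\theta_2 2^{-j}$ and mass $p$. By (A5) its covariance has a
    spectral gap of order $r^2$, so [davis_kahan] turns a relative error of the empirical covariance
    into an error of the same order for the projection. It is derived in Frobenius norm from Ky
    Fan's principle and its quantitative form ([trace_top_max], [trace_top_gap]) and uses the gap of
    the true covariance only, hence tolerates ties in the empirical one. The sample count, the
    centred sum and the centred covariance sum deviate by at most $t$, $2rt$ and $2r^2t$ with
    $t=\sqrt{Knp\log n}$, except with probability $6n^{-K/12}$. This rests on [deviation_bound], a
    Bernstein inequality in Euclidean norm with constants free of the dimension, which is why $C_1$
    and $C_2$ do not involve $D$. It is proved by Pinelis' method: the mean of $\cosh(\lambda|S_m|)$
    grows by a factor at most $1+3\lambda^2p$ per sample ([cosh_vnorm_add], [cosh_moment]). Cells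
    with $p<4K\log n/n$ are treated by the crude bound $3r$. In both regimes $p$ times the squared
    error is at most a constant times $r^2\log n/n$ ([cell_error]).

    Summing over at most $2^{jd}/\theta_1$ cells gives the order $2^{j(d-2)}\log n/n$, which at the
    chosen scale is the square of the target rate ([scale_error_identity]). Since $s\ge1$, there are
    at most of order $n/\log n$ cells ([ln_ratio_le_scale]); with $K=12(\nu+1)$ the union bound then
    leaves $C_2n^{-\nu}$ with $C_2$ independent of $\nu$. *)

(** * Euclidean norms *)

Section vnorm.
Context {R : realType} {I : finType}.
Implicit Types a b : I -> R.

(** The index type is an arbitrary finite type so that one concentration inequality serves scalars
    ([unit]), vectors (['I_D]) and matrices (['I_D * 'I_D]). *)
Definition vnorm a : R := Num.sqrt (\sum_i a i ^+ 2).

Lemma vnorm_ge0 a : 0 <= vnorm a. Proof. exact: sqrtr_ge0. Qed.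

Lemma sumsq_ge0 a : 0 <= \sum_i a i ^+ 2.
Proof. by apply: sumr_ge0 => i _; exact: sqr_ge0. Qed.

Lemma sqr_vnorm a : vnorm a ^+ 2 = \sum_i a i ^+ 2.
Proof. by rewrite sqr_sqrtr ?sumsq_ge0. Qed.

Lemma vnorm0P a : vnorm a = 0 -> forall i, a i = 0.
Proof.
move=> a0 i; have /eqP := sqr_vnorm a; rewrite a0 expr0n /= eq_sym.
rewrite psumr_eq0 => [|j _]; last exact: sqr_ge0.
by move=> /allP/(_ i (mem_index_enum _)); rewrite sqrf_eq0 => /eqP.
Qed.

Lemma eq_vnorm a b : a =1 b -> vnorm a = vnorm b.
Proof. by move=> ab; congr Num.sqrt; apply: eq_bigr => i _; rewrite ab. Qed.

Lemma vnormZ (c : R) a : vnorm (fun i => c * a i) = `|c| * vnorm a.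
Proof.
rewrite /vnorm; under eq_bigr do rewrite exprMn.
by rewrite -mulr_sumr sqrtrM ?sqr_ge0 // sqrtr_sqr.
Qed.

Lemma cauchy_schwarz a b : `|\sum_i a i * b i| <= vnorm a * vnorm b.
Proof.
have [a0|a0] := eqVneq (vnorm a) 0.
  by rewrite a0 mul0r big1 ?normr0 // => i _; rewrite (vnorm0P a0) mul0r.
have agt0 : 0 < vnorm a by rewrite lt_def a0 vnorm_ge0.
rewrite -(@ler_pXn2r _ 2) ?nnegrE ?mulr_ge0 ?vnorm_ge0 // exprMn.
set s := \sum_i a i * b i; rewrite real_normK ?num_real //.
set A := vnorm a ^+ 2; have A0 : 0 < A by rewrite exprn_gt0.
(* Expanding this sum of squares gives $A(A|b|^2-s^2)\ge0$ with $A=|a|^2$. *)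
have : 0 <= \sum_i (A * b i - s * a i) ^+ 2.
  by apply: sumr_ge0 => i _; exact: sqr_ge0.
under eq_bigr => i _.
  have -> : (A * b i - s * a i) ^+ 2 = A ^+ 2 * b i ^+ 2
    - (2 * A * s * (a i * b i) - s ^+ 2 * a i ^+ 2) by ring.
  over.
rewrite sumrB sumrB -!mulr_sumr -!sqr_vnorm -/s -/A => h.
rewrite -subr_ge0 -(pmulr_rge0 _ A0).
suff -> : A * (A * vnorm b ^+ 2 - s ^+ 2) =
  A ^+ 2 * vnorm b ^+ 2 - (2 * A * s * s - s ^+ 2 * A) by [].
by ring.
Qed.

Lemma vnormD a b : vnorm (fun i => a i + b i) <= vnorm a + vnorm b.
Proof.
rewrite -(@ler_pXn2r _ 2) ?nnegrE ?addr_ge0 ?vnorm_ge0 // sqr_vnorm.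
have -> : \sum_i (a i + b i) ^+ 2 =
    vnorm a ^+ 2 + 2 * (\sum_i a i * b i) + vnorm b ^+ 2.
  by rewrite !sqr_vnorm mulr_sumr -!big_split; apply: eq_bigr => i _ /=; ring.
by have := cauchy_schwarz a b; have := ler_norm (\sum_i a i * b i); lra.
Qed.

Lemma vnorm0 : vnorm (fun=> 0) = 0.
Proof. by rewrite /vnorm big1 ?sqrtr0 // => i _; rewrite expr0n. Qed.

Lemma vnormN a : vnorm (fun i => - a i) = vnorm a.
Proof. by congr Num.sqrt; apply: eq_bigr => i _; rewrite sqrrN. Qed.

End vnorm.

Section enorm.
Context {R : realType} {D : nat}.
Implicit Types x y : 'rV[R]_D.

Lemma enormE x : enorm x = vnorm (x ord0). Proof. by []. Qed.

Lemma enorm_ge0 x : 0 <= enorm x. Proof. exact: sqrtr_ge0. Qed.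

Lemma enormD x y : enorm (x + y) <= enorm x + enorm y.
Proof.
rewrite !enormE (le_trans _ (vnormD _ _)) // (@eq_vnorm _ _ _ (fun i => x 0 i + y 0 i)) //.
by move=> i; rewrite mxE.
Qed.

Lemma enormN x : enorm (- x) = enorm x.
Proof. by rewrite !enormE -vnormN; apply: eq_vnorm => i; rewrite mxE opprK. Qed.

Lemma enormZ (c : R) x : enorm (c *: x) = `|c| * enorm x.
Proof. by rewrite !enormE -vnormZ; apply: eq_vnorm => i; rewrite mxE. Qed.

Lemma enorm0 : enorm (0 : 'rV[R]_D) = 0.
Proof. by rewrite -(scale0r 0) enormZ normr0 mul0r. Qed.

Lemma enorm_eq0 x : enorm x = 0 -> x = 0.
Proof. by move=> /vnorm0P x0; apply/rowP => i; rewrite x0 mxE. Qed.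

Lemma sqr_enorm x : enorm x ^+ 2 = (x *m x^T) 0 0.
Proof. by rewrite sqr_vnorm mxE; apply: eq_bigr => i _; rewrite mxE expr2. Qed.

Lemma coord_le_enorm x i : `|x 0 i| <= enorm x.
Proof.
rewrite -(@ler_pXn2r _ 2) ?nnegrE ?enorm_ge0 // real_normK ?num_real //.
rewrite enormE sqr_vnorm (bigD1 i) //= lerDl.
by apply: sumr_ge0 => j _; exact: sqr_ge0.
Qed.

End enorm.

(** * The Frobenius norm *)

Section frobenius.
Context {R : realType}.

Definition frob m n (A : 'M[R]_(m, n)) : R :=
  vnorm (fun ij : 'I_m * 'I_n => A ij.1 ij.2).

Lemma frob_ge0 m n (A : 'M[R]_(m, n)) : 0 <= frob A.
Proof. exact: vnorm_ge0. Qed.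

Lemma sqr_frob m n (A : 'M[R]_(m, n)) : frob A ^+ 2 = \tr (A *m A^T).
Proof.
rewrite sqr_vnorm -(pair_bigA _ (fun i j => A i j ^+ 2)) /=.
by apply: eq_bigr => i _; rewrite mxE; apply: eq_bigr => j _; rewrite mxE expr2.
Qed.

Lemma trace_mul_le m n (A B : 'M[R]_(m, n)) : \tr (A *m B^T) <= frob A * frob B.
Proof.
apply: le_trans (ler_norm _) _; apply: le_trans (cauchy_schwarz _ _).
rewrite -(pair_bigA _ (fun i j => A i j * B i j)) /=.
rewrite (_ : \tr _ = \sum_i \sum_j A i j * B i j) //.
by apply: eq_bigr => i _; rewrite mxE; apply: eq_bigr => j _; rewrite mxE.
Qed.

Lemma frobD m n (A B : 'M[R]_(m, n)) : frob (A + B) <= frob A + frob B.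
Proof.
rewrite (le_trans _ (vnormD _ _)) // /frob (@eq_vnorm _ _ _ (fun i => A i.1 i.2 + B i.1 i.2)) //.
by move=> i; rewrite mxE.
Qed.

Lemma frobN m n (A : 'M[R]_(m, n)) : frob (- A) = frob A.
Proof. by rewrite /frob -vnormN; apply: eq_vnorm => i; rewrite mxE opprK. Qed.

Lemma frobZ m n (c : R) (A : 'M[R]_(m, n)) : frob (c *: A) = `|c| * frob A.
Proof. by rewrite /frob -vnormZ; apply: eq_vnorm => i; rewrite mxE. Qed.

Lemma frob_outer n (x y : 'rV[R]_n) : frob (x^T *m y) = enorm x * enorm y.
Proof.
apply/eqP; rewrite -(@eqrXn2 _ 2) ?frob_ge0 ?mulr_ge0 ?enorm_ge0 //.
rewrite exprMn !sqr_enorm sqr_frob trmx_mul trmxK mulmxA -(mulmxA x^T) mxtrace_mulC.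
rewrite !mulmxA [in X in _ == X]mulrC.
by rewrite -mulmxA [y *m _]mx11_scalar mul_mx_scalar mxtraceZ [x *m _]mx11_scalar
  mxtrace_scalar !mxE.
Qed.

(** Cauchy-Schwarz applied to each column of [A]. *)
Lemma enorm_mulmx_le m n (x : 'rV[R]_m) (A : 'M[R]_(m, n)) :
  enorm (x *m A) <= enorm x * frob A.
Proof.
rewrite -(@ler_pXn2r _ 2) ?nnegrE ?mulr_ge0 ?enorm_ge0 ?frob_ge0 // exprMn.
rewrite [leLHS]sqr_vnorm [frob _ ^+ 2]sqr_vnorm.
rewrite -(pair_bigA _ (fun i j => A i j ^+ 2)) /= exchange_big /= mulr_sumr.
apply: ler_sum => j _; rewrite mxE -(sqr_vnorm (fun i => A i j)) -exprMn.
rewrite -[leLHS]real_normK ?num_real // ler_pXn2r ?nnegrE ?mulr_ge0 ?vnorm_ge0 //.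
exact: cauchy_schwarz.
Qed.

End frobenius.

(** * Orthogonal projections as matrices *)

Section projection.
Context {R : realType} {d D : nat}.
Implicit Types (V : 'M[R]_(d, D)) (x : 'rV[R]_D).

(** Matrix of the orthogonal projection onto the row space of [V]. The inverse Gram matrix is there
    because [top_eigenvectors] asks for independent rows, not for orthonormal ones. *)
Definition projm V : 'M[R]_D := V^T *m invmx (V *m V^T) *m V.

Lemma sqr_row_eq0 n (x : 'rV[R]_n) : x *m x^T = 0 -> x = 0.
Proof.
move=> xx; apply: enorm_eq0; apply/eqP; rewrite -(@eqrXn2 _ 2) ?enorm_ge0 //.
by rewrite sqr_enorm xx mxE expr0n.
Qed.

(** A vector $u$ killed by the Gram matrix satisfies $|uV|^2=0$, and then independence of the rows
    forces $u=0$. *)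
Lemma gram_unit V : row_free V -> V *m V^T \in unitmx.
Proof.
move=> fV; rewrite -row_free_unit -kermx_eq0; apply/eqP/row_matrixP => i.
rewrite row0; set u := row i _; have uVV : u *m (V *m V^T) = 0.
  by apply/sub_kermxP; exact: row_sub.
have /sqr_row_eq0 : (u *m V) *m (u *m V)^T = 0.
  by rewrite trmx_mul mulmxA -(mulmxA u) uVV mul0mx.
by move=> uV0; apply: (row_free_inj fV); rewrite uV0 mul0mx.
Qed.

Lemma trmx_projm V : (projm V)^T = projm V.
Proof.
rewrite /projm !trmx_mul trmxK trmx_inv trmx_mul trmxK.
by rewrite mulmxA.
Qed.

Lemma mulV_projm V : row_free V -> V *m projm V = V.
Proof. by move=> fV; rewrite /projm !mulmxA mulmxV ?gram_unit // mul1mx. Qed.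

Lemma projmK V : row_free V -> projm V *m projm V = projm V.
Proof. by move=> fV; rewrite {1}/projm -mulmxA mulV_projm. Qed.

Lemma mxtrace_projm V : row_free V -> \tr (projm V) = d%:R.
Proof.
by move=> fV; rewrite /projm mxtrace_mulC mulmxA mulmxV ?gram_unit // mxtrace1.
Qed.

(** The row space of [V] meets the kernel of $V^T$ only in 0, so [proj_mx] reads off the first
    summand of $x=x\Pi+(x-x\Pi)$, where $\Pi$ is [projm V]. *)
Lemma orthprojE V x : row_free V -> orthproj V x = x *m projm V.
Proof.
move=> fV; rewrite /orthproj.
have dV : (<<V>> :&: kermx V^T)%MS = 0.
  apply/eqP; rewrite -submx0; apply/rV_subP => u.
  rewrite sub_capmx genmxE => /andP[/submxP[w ->]] /sub_kermxP.
  rewrite -mulmxA => wVV; rewrite (_ : w = 0) ?mul0mx ?sub0mx //.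
  by rewrite -(mulmxK (gram_unit fV) w) wVV mul0mx.
rewrite -{1}[x](subrK (x *m projm V)) mulmxDl.
rewrite proj_mx_0 ?add0r ?proj_mx_id //.
- by rewrite genmxE /projm !mulmxA submxMl.
- apply/sub_kermxP; rewrite mulmxBl -mulmxA.
  have -> : projm V *m V^T = V^T.
    by rewrite -[projm V]trmx_projm -trmx_mul mulV_projm.
  by rewrite subrr.
Qed.

End projection.

Section symmetric_idempotent.
Context {R : realType} {D : nat}.
Variable Q : 'M[R]_D.
Hypotheses (QT : Q^T = Q) (QQ : Q *m Q = Q).

Lemma sqr_enorm_proj (x : 'rV[R]_D) : enorm (x *m Q) ^+ 2 = (x *m Q *m x^T) 0 0.
Proof. by rewrite sqr_enorm trmx_mul QT mulmxA -(mulmxA x) QQ. Qed.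

(** Pythagoras: $xQ$ and $x-xQ$ are orthogonal. *)
Lemma sqr_enorm_projC (x : 'rV[R]_D) :
  enorm (x - x *m Q) ^+ 2 = enorm x ^+ 2 - enorm (x *m Q) ^+ 2.
Proof.
rewrite sqr_enorm_proj !sqr_enorm linearB /= trmx_mul QT.
rewrite mulmxBl !mulmxBr !mulmxA -(mulmxA x Q Q) QQ subrr subr0.
by rewrite !mxE.
Qed.

Lemma enorm_proj_le (x : 'rV[R]_D) : enorm (x *m Q) <= enorm x.
Proof.
rewrite -(@ler_pXn2r _ 2) ?nnegrE ?enorm_ge0 // -subr_ge0 -sqr_enorm_projC.
exact: sqr_ge0.
Qed.

Lemma enorm_projC_le (x : 'rV[R]_D) : enorm (x - x *m Q) <= enorm x.
Proof.
rewrite -(@ler_pXn2r _ 2) ?nnegrE ?enorm_ge0 // -subr_ge0 sqr_enorm_projC.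
by rewrite opprB addrCA subrr addr0 sqr_ge0.
Qed.

End symmetric_idempotent.

(** * The spectral theorem for real symmetric matrices *)

Section spectral.
Context {R : realType}.

(** Over the complex numbers the matrix is Hermitian, so its spectral diagonal is real. An entry of
    it is a root of the characteristic polynomial, whose coefficients are real, so it has a real
    eigenvector as well. *)
Lemma symmetric_eigenvector n (A : 'M[R]_n.+1) : A^T = A ->
  exists (v : 'rV_n.+1) (a : R), v *m A = a *: v /\ v *m v^T = 1%:M.
Proof.
move=> AT; pose AC := map_mx (real_complex R) A.
have Areal : AC \is a mxOver Num.real.
  by apply/mxOverP => i j; rewrite mxE; apply/complex_realP; eexists.
have Asym : AC \is symmetricmx.
  by apply/is_hermitianmxP; rewrite expr0 scale1r map_mx_id // map_trmx AT.
have Aherm := realsym_hermsym Asym Areal.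
have /mxOverP/(_ 0 0)/complex_realP[x Dx] := hermitian_spectral_diag_real Aherm.
have /orthomx_spectralP AE := hermitian_normalmx Aherm.
have Pu := spectral_unit AC; set P := spectralmx AC in AE Pu.
have : eigenvalue AC (real_complex R x).
  apply/eigenvalueP; exists (row 0 P).
    rewrite -row_mul (_ : P *m AC = diag_mx (spectral_diag AC) *m P).
      by rewrite row_mul row_diag_mx -scalemxAl -rowE Dx.
    by rewrite [in LHS]AE -mulmxA mulKVmx.
  have : row_free P by rewrite row_free_unit.
  move=> /row_freeP[Q PQ]; apply/eqP => P0.
  have /matrixP/(_ 0 0) := congr1 (row 0) PQ.
  rewrite row_mul P0 mul0mx !mxE /= => /eqP.
  by rewrite eq_sym oner_eq0.
rewrite eigenvalue_root_char -map_char_poly fmorph_root -eigenvalue_root_char.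
move=> /eigenvalueP[w wA w0].
have nw : enorm w != 0 by apply: contra w0 => /eqP/enorm_eq0 ->.
exists ((enorm w)^-1 *: w), x; split.
  by rewrite -scalemxAl wA !scalerA mulrC.
rewrite linearZ /= -scalemxAl -scalemxAr scalerA [w *m _]mx11_scalar -sqr_enorm.
by rewrite scale_scalar_mx; congr (_%:M); field.
Qed.

(* Householder reflection exchanging v and the first basis vector. *)
Lemma orthogonal_first_row n (v : 'rV[R]_n.+1) : v *m v^T = 1%:M ->
  exists2 H : 'M[R]_n.+1, H *m H^T = 1%:M & row 0 H = v.
Proof.
move=> v1; pose e : 'rV[R]_n.+1 := delta_mx 0 0.
have [w wdef] : exists w : 'rV[R]_n.+1, w = v - e by exists (v - e).
have eT : e *m e^T = 1%:M.
  by rewrite trmx_delta mul_delta_mx; apply/matrixP => i j; rewrite !ord1 !mxE.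
(* If [v] is the first basis vector, the reflection is undefined and the identity serves. *)
have [w0|w0] := eqVneq (enorm w) 0.
  exists 1%:M; first by rewrite trmx1 mulmx1.
  by rewrite row1; apply/esym/eqP; rewrite -subr_eq0 -wdef; apply/eqP/enorm_eq0.
pose c := 2 / enorm w ^+ 2.
have ww : w *m w^T = (enorm w ^+ 2)%:M by rewrite [LHS]mx11_scalar -sqr_enorm.
pose H := 1%:M - c *: (w^T *m w); exists H.
  have -> : H^T = H.
    by rewrite /H linearB /= trmx1 linearZ /= trmx_mul trmxK.
  rewrite /H mulmxBl mul1mx mulmxBr mulmx1 -scalemxAl -scalemxAr scalerA.
  rewrite -mulmxA (mulmxA w) ww mul_scalar_mx -scalemxAr scalerA.
  rewrite -scalerBl -addrA -opprD -scalerDl.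
  rewrite (_ : c + _ = 0) ?scale0r ?subr0 //.
  by rewrite /c; field.
pose t := (v *m e^T) 0 0.
have ve : v *m e^T = t%:M by rewrite [LHS]mx11_scalar.
have ev : e *m v^T = t%:M by rewrite -[LHS]trmxK trmx_mul trmxK ve tr_scalar_mx.
have wE : enorm w ^+ 2 = 2 - 2 * t.
  rewrite sqr_enorm wdef linearB /= mulmxBl !mulmxBr v1 eT ve ev !mxE /=.
  by rewrite !mulr1n; ring.
rewrite rowE -/e /H mulmxBr mulmx1 -scalemxAr mulmxA.
have -> : e *m w^T = (t - 1)%:M.
  by rewrite wdef linearB /= mulmxBr ev eT [RHS]raddfB.
rewrite mul_scalar_mx scalerA.
have cE : c * (t - 1) = -1.
  have t1 : 2 - 2 * t != 0 by rewrite -wE expf_eq0.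
  by rewrite /c wE; field.
by rewrite cE scaleN1r opprK wdef addrC subrK.
Qed.

(** Deflation: in an orthonormal basis starting with a unit eigenvector the matrix is block
    diagonal, with a scalar block and a smaller symmetric block to which induction applies. *)
Lemma symmetric_diagonalizable n (A : 'M[R]_n) : A^T = A ->
  exists (U : 'M[R]_n) (lam : 'rV[R]_n),
    U *m U^T = 1%:M /\ U *m A = diag_mx lam *m U.
Proof.
elim: n A => [A _|n IH A AT].
  by exists 1%:M, 0; split; apply/matrixP => -[].
have [v [a [vA v1]]] := symmetric_eigenvector AT.
have [H HH Hv] := orthogonal_first_row v1.
have HTH : H^T *m H = 1%:M by apply: mulmx1C.
have [B BE] : exists B : 'M[R]_(1 + n), B = H *m A *m H^T by eexists.
have BT : B^T = B by rewrite BE !trmx_mul trmxK AT mulmxA.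
have B0 : row 0 B = a *: delta_mx 0 0.
  by rewrite BE !row_mul Hv vA -Hv -scalemxAl -row_mul HH row1.
have Bur : ursubmx B = 0.
  apply/rowP => j; rewrite !mxE.
  have -> : lshift n (0 : 'I_1) = 0 by apply/val_inj.
  have /rowP/(_ (rshift 1 j)) := B0.
  by rewrite !mxE /= mulr0.
have Bul : ulsubmx B = a%:M.
  apply/matrixP => i j; rewrite !ord1 !mxE.
  have -> : lshift n (0 : 'I_1) = 0 by apply/val_inj.
  by have /rowP/(_ 0) := B0; rewrite !mxE /= mulr1 mulr1n.
have Bdl : dlsubmx B = 0.
  by rewrite -[B]BT -trmx_ursub Bur trmx0.
have [U' [lam' [UU' AU']]] : exists (U : 'M[R]_n) (lam : 'rV[R]_n),
    U *m U^T = 1%:M /\ U *m drsubmx B = diag_mx lam *m U.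
  by apply: IH; rewrite trmx_drsub BT.
pose W : 'M[R]_(1 + n) := block_mx 1%:M 0 0 U'.
exists (W *m H), (row_mx a%:M lam'); split.
  have WW : W *m W^T = 1%:M.
    rewrite /W (tr_block_mx 1%:M) mulmx_block !trmx0 trmx1.
    by rewrite !(mul0mx, mulmx0, mulmx1, add0r, addr0) UU' -scalar_mx_block.
  by rewrite trmx_mul mulmxA -(mulmxA W) HH mulmx1.
have AE : H *m A = B *m H.
  have -> : B *m H = H *m A *m (H^T *m H) by rewrite BE mulmxA.
  by rewrite HTH mulmx1.
have WB : W *m B = diag_mx (row_mx a%:M lam' : 'rV_(1 + n)) *m W.
  rewrite -[B]submxK Bur Bul Bdl /W diag_mx_row !mulmx_block.
  rewrite !(mul0mx, mulmx0, mulmx1, mul1mx, add0r, addr0) AU'.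
  by congr block_mx; apply/matrixP => i j; rewrite !ord1 !mxE.
by rewrite -mulmxA AE (mulmxA W B H) WB -mulmxA.
Qed.

Lemma char_poly_conj n (A B U : 'M[R]_n) :
  U *m U^T = 1%:M -> U *m A = B *m U -> char_poly A = char_poly B.
Proof.
move=> UU UAB; rewrite /char_poly; set UP := map_mx polyC U.
have UU' : UP *m map_mx polyC U^T = 1%:M by rewrite -map_mxM UU map_mx1.
have E : UP *m char_poly_mx A = char_poly_mx B *m UP.
  rewrite /char_poly_mx mulmxBr mulmxBl -scalar_mxC /UP -!map_mxM UAB.
  by congr (_ - _).
have := congr1 determinant E; rewrite !det_mulmx mulrC => /mulIf; apply.
have : \det UP * \det (map_mx polyC U^T) != 0.
  by rewrite -det_mulmx UU' det1 oner_eq0.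
by apply: contra => /eqP ->; rewrite mul0r.
Qed.

(** Discharges the choice in [eigvals]: the sorted diagonal of an orthogonal diagonalisation is a
    witness. *)
Lemma eigvals_spec n (A : 'M[R]_n) : A^T = A ->
  sorted >=%R (eigvals A) /\
  char_poly A = \prod_(a <- eigvals A) ('X - a%:P).
Proof.
move=> AT; rewrite /eigvals.
set P := [set _ | _]; suff : P (xget [::] P) by [].
apply: xgetPex; have [U [lam [UU UA]]] := symmetric_diagonalizable AT.
exists (sort >=%R [seq lam 0 i | i <- enum 'I_n]); split.
  by apply: sort_sorted => x y; exact: le_total.
rewrite (char_poly_conj UU UA) char_poly_trig ?diag_mx_is_trig //.
rewrite (perm_big _ (permEl (perm_sort _ _))) big_map big_enum /=.
by apply: eq_bigr => i _; rewrite mxE eqxx mulr1n.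
Qed.

(** Unique factorisation of the characteristic polynomial makes [eigvals A] a permutation of the
    diagonal of an orthogonal diagonalisation; the rows of [U] are permuted accordingly. *)
Lemma orthonormal_eigenbasis n (A : 'M[R]_n) : A^T = A ->
  size (eigvals A) = n /\
  exists2 U : 'M[R]_n, U *m U^T = 1%:M &
    forall i : 'I_n, row i U *m A = (eigvals A)`_i *: row i U.
Proof.
move=> AT; have [srt cpE] := eigvals_spec AT.
have [U [lam [UU UA]]] := symmetric_diagonalizable AT.
have : perm_eq (eigvals A) [seq lam 0 i | i <- enum 'I_n].
  apply: prod_XsubC_eq; rewrite -cpE (char_poly_conj UU UA).
  rewrite char_poly_trig ?diag_mx_is_trig // big_map big_enum /=.
  by apply: eq_bigr => i _; rewrite mxE eqxx mulr1n.
move=> permE; have szE : size (eigvals A) = n.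
  by rewrite (perm_size permE) size_map size_enum_ord.
split => //; case: n A AT srt cpE U lam UU UA permE szE => [|n] A AT srt cpE U lam UU UA permE szE.
  by exists 1%:M; [apply/matrixP => -[] | case].
have /(perm_iotaP 0)[Is permI IsE] := permE.
rewrite size_map size_enum_ord in permI.
have szI : size Is = n.+1 by rewrite (perm_size permI) size_iota.
have uI : uniq Is by rewrite (perm_uniq permI) iota_uniq.
pose f (i : 'I_n.+1) : 'I_n.+1 := inord (nth 0%N Is i).
have ltI (i : 'I_n.+1) : (nth 0%N Is i < n.+1)%N.
  have : nth 0%N Is i \in Is by rewrite mem_nth ?szI.
  by rewrite (perm_mem permI) mem_iota add0n => /andP[].
have fI : injective f.
  move=> i j /(congr1 val); rewrite /= !inordK // => /eqP.
  by rewrite nth_uniq ?szI // => /eqP/val_inj.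
have lamE (i : 'I_n.+1) : (eigvals A)`_i = lam 0 (f i).
  rewrite IsE (nth_map 0%N) ?szI // (nth_map ord0) ?size_enum_ord //.
  by congr (lam 0 _); apply: val_inj; rewrite /= nth_enum_ord // inordK.
exists (\matrix_i row (f i) U).
  apply/matrixP => i j; rewrite !mxE.
  have /matrixP/(_ (f i) (f j)) := UU; rewrite !mxE (inj_eq fI) => <-.
  by apply: eq_bigr => k _; rewrite !mxE.
by move=> i; rewrite rowK -row_mul UA row_mul row_diag_mx -scalemxAl -rowE lamE.
Qed.

Lemma top_eigenvectors_exist d D (A : 'M[R]_D) : A^T = A -> (d <= D)%N ->
  exists V : 'M[R]_(d, D), top_eigenvectors A V.
Proof.
move=> AT dD; have [_ [U UU UA]] := orthonormal_eigenbasis AT.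
pose V := \matrix_(i < d) row (widen_ord dD i) U.
exists V; split; last by move=> i; rewrite rowK UA.
apply/row_freeP; exists V^T; apply/matrixP => i j.
have /matrixP/(_ (widen_ord dD i) (widen_ord dD j)) := UU.
by rewrite !mxE /= -(inj_eq val_inj) => <-; apply: eq_bigr => k _; rewrite !mxE.
Qed.

End spectral.

(** * Traces in an orthonormal basis, Ky Fan's principle and the Davis-Kahan bound *)

Section orthogonal_basis.
Context {R : realType} {D : nat}.
Variable U : 'M[R]_D.
Hypothesis UU : U *m U^T = 1%:M.

Lemma enorm_row_orthogonal l : enorm (row l U) = 1.
Proof.
apply/eqP; rewrite -(@eqrXn2 _ 2) ?enorm_ge0 // expr1n sqr_enorm.
have /matrixP/(_ l l) := UU; rewrite !mxE eqxx => UUl; apply/eqP.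
by rewrite -[RHS]UUl; apply: eq_bigr => k _; rewrite !mxE.
Qed.

Lemma mxtrace_basis (B : 'M[R]_D) :
  \tr B = \sum_l (row l U *m B *m (row l U)^T) 0 0.
Proof.
have -> : \tr B = \tr (U *m B *m U^T).
  by rewrite mxtrace_mulC mulmxA (mulmx1C UU) mul1mx.
by apply: eq_bigr => l _; rewrite -row_mul !mxE; apply: eq_bigr => k _; rewrite !mxE.
Qed.

Lemma sum_sqr_enorm_proj (Q : 'M[R]_D) : Q^T = Q -> Q *m Q = Q ->
  \sum_l enorm (row l U *m Q) ^+ 2 = \tr Q.
Proof.
move=> QT QQ; rewrite mxtrace_basis; apply: eq_bigr => l _.
by rewrite sqr_enorm_proj.
Qed.

Lemma proj_row_orthogonal_le1 (Q : 'M[R]_D) l : Q^T = Q -> Q *m Q = Q ->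
  enorm (row l U *m Q) ^+ 2 <= 1.
Proof.
move=> QT QQ; rewrite -(expr1n _ 2) -(enorm_row_orthogonal l).
by rewrite ler_pXn2r ?nnegrE ?enorm_ge0 ?enorm_proj_le.
Qed.

Lemma projm_perp d (V : 'M[R]_(d, D)) (x : 'rV[R]_D) :
  V *m x^T = 0 -> x *m projm V = 0.
Proof.
by move=> /(congr1 trmx); rewrite trmx_mul trmxK trmx0 /projm !mulmxA => ->;
  rewrite !mul0mx.
Qed.

(* The m numbers |u_l Pi|^2, l < m, are at most 1 and sum to the trace m. *)
Lemma projm_fixes_rows m (W : 'M[R]_(m, D)) : (m <= D)%N -> row_free W ->
  (forall l : 'I_D, (m <= l)%N -> W *m (row l U)^T = 0) ->
  forall l : 'I_D, (l < m)%N -> row l U *m projm W = row l U.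
Proof.
move=> mD fW Wl.
have QT := trmx_projm W; have QQ := projmK fW.
have sum0 : \sum_(l < D) ((l < m)%N%:R - enorm (row l U *m projm W) ^+ 2) = 0.
  rewrite sumrB sum_sqr_enorm_proj // mxtrace_projm //.
  rewrite (eq_bigr (fun l : 'I_D => if (l < m)%N then 1 else 0)); last first.
    by move=> l _; case: ifP.
  by rewrite -big_mkcond /= -(big_ord_widen D (fun=> 1) mD) sumr_const card_ord subrr.
have term_ge0 (l : 'I_D) :
    0 <= (l < m)%N%:R - enorm (row l U *m projm W) ^+ 2.
  case: ltnP => lm; first by rewrite subr_ge0 proj_row_orthogonal_le1.
  by rewrite projm_perp ?Wl // enorm0 expr0n subr0.
move/eqP: sum0; rewrite psumr_eq0 => [/allP h l lm|l _]; last exact: term_ge0.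
have := h l (mem_index_enum _); rewrite lm /= subr_eq0 => /eqP c1.
apply/esym/eqP; rewrite -subr_eq0; apply/eqP/enorm_eq0/eqP.
rewrite -(@eqrXn2 _ 2) ?enorm_ge0 // sqr_enorm_projC //.
by rewrite -c1 enorm_row_orthogonal expr1n subrr expr0n.
Qed.

End orthogonal_basis.

Section rayleigh.
Context {R : realType} {D : nat}.

Lemma eigenvectors_orthogonal (A : 'M[R]_D) (x y : 'rV[R]_D) (a b : R) :
  A^T = A -> x *m A = a *: x -> y *m A = b *: y -> a != b -> x *m y^T = 0.
Proof.
move=> AT xA yA ab; have : a *: (x *m y^T) = b *: (x *m y^T).
  by rewrite scalemxAl -xA scalemxAr -linearZ -yA /= trmx_mul AT mulmxA.
move/eqP; rewrite -subr_eq0 -scalerBl scaler_eq0 subr_eq0 (negbTE ab) /=.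
by move=> /eqP.
Qed.

Lemma trace_eigenbasis (A U Q : 'M[R]_D) (lam : 'I_D -> R) :
  U *m U^T = 1%:M -> (forall i, row i U *m A = lam i *: row i U) ->
  Q^T = Q -> Q *m Q = Q ->
  \tr (A *m Q) = \sum_l lam l * enorm (row l U *m Q) ^+ 2.
Proof.
move=> UU UA QT QQ; rewrite (mxtrace_basis UU); apply: eq_bigr => l _.
by rewrite sqr_enorm_proj // mulmxA UA -!scalemxAl mxE.
Qed.

Lemma eigvals_nonincr (A : 'M[R]_D) (i j : nat) : A^T = A ->
  (i <= j)%N -> (j < D)%N -> (eigvals A)`_j <= (eigvals A)`_i.
Proof.
move=> AT ij jD; have [srt _] := eigvals_spec AT.
have [sz _] := orthonormal_eigenbasis AT.
have := sorted_leq_nth (T := R) (leT := >=%R).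
move=> /(_ (fun y x z => @ge_trans _ _ y x z)) h.
by apply: (h (fun x => lexx x) 0 _ srt) => //; rewrite inE sz //; lia.
Qed.

Variables (d : nat) (A : 'M[R]_D) (V : 'M[R]_(d, D)).
Hypotheses (d0 : (0 < d)%N) (dD : (d <= D)%N) (AT : A^T = A).
Hypothesis topV : top_eigenvectors A V.

Let fV : row_free V. Proof. by case: topV. Qed.

(* Ky Fan's maximum principle. *)
Lemma trace_top_max (Q : 'M[R]_D) : Q^T = Q -> Q *m Q = Q -> \tr Q = d%:R ->
  \tr (A *m Q) <= \tr (A *m projm V).
Proof.
move=> QT QQ Qd; have [sz [U UU UA]] := orthonormal_eigenbasis AT.
have PT := trmx_projm V; have PP := projmK fV; have Pd := mxtrace_projm fV.
set lam := eigvals A in sz UA; pose a := lam`_(d.-1).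
rewrite !(trace_eigenbasis UU UA) // -subr_ge0.
(* Both projections have trace $d$, so the $d$-th eigenvalue [a] may be subtracted from all
   eigenvalues; every summand is then nonnegative. *)
have -> : \sum_(l < D) lam`_l * enorm (row l U *m projm V) ^+ 2 -
    \sum_(l < D) lam`_l * enorm (row l U *m Q) ^+ 2 =
  \sum_(l < D) (lam`_l - a) * (enorm (row l U *m projm V) ^+ 2 -
     enorm (row l U *m Q) ^+ 2) + a * (\tr (projm V) - \tr Q).
  rewrite -!(sum_sqr_enorm_proj UU) // -!sumrB mulr_sumr -big_split.
  by apply: eq_bigr => l _ /=; ring.
rewrite Pd Qd subrr mulr0 addr0; apply: sumr_ge0 => l _.
(* Below [a], the vector $u_l$ is orthogonal to the rows of [V]; at [a] the summand vanishes; above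
   [a], treated last, $u_l$ lies in the row space of [V]. Ties at [a] are thus harmless. *)
have [lt_la|lt_al|->] := ltgtP lam`_l a; last by rewrite subrr mul0r.
  rewrite projm_perp ?enorm0 ?expr0n ?sub0r.
    by rewrite mulr_le0 // ?subr_le0 ?oppr_le0 ?sqr_ge0 // ltW.
  apply/row_matrixP => i; rewrite row0 row_mul.
  apply: (eigenvectors_orthogonal AT (topV.2 i) (UA l)).
  rewrite neq_lt; apply/orP; right; apply: lt_le_trans lt_la _.
  by apply: eigvals_nonincr => //; [have := ltn_ord i|]; lia.
(* [m] eigenvalues exceed [a]. The first [m] rows of [V] belong to them and are orthogonal to $u_k$
   for $k\ge m$, hence span the same space as $u_0,\dots,u_{m-1}$. *)
pose m := find (fun x => x <= a) lam.
have hasa : has (fun x => x <= a) lam.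
  by apply/hasP; exists a => //; apply: mem_nth; rewrite sz; lia.
have md : (m <= d.-1)%N.
  rewrite leqNgt; apply/negP => /(before_find 0) /=.
  by rewrite -/a lexx.
have lm : (l < m)%N.
  rewrite ltnNge; apply/negP => ml; have := nth_find 0 hasa; rewrite -/m.
  by move=> /(le_trans (eigvals_nonincr AT ml (ltn_ord l))); rewrite leNgt lt_al.
have md' : (m <= d)%N by lia.
pose E := \matrix_(i < m) (delta_mx 0 (widen_ord md' i) : 'rV[R]_d).
have WE i : row i (E *m V) = row (widen_ord md' i) V.
  by rewrite row_mul rowK -rowE.
have EET : E *m E^T = 1%:M.
  apply/matrixP => i j; rewrite !mxE (bigD1 (widen_ord md' i)) //= !mxE !eqxx mul1r.
  rewrite big1 ?addr0 => [|k kn]; last by rewrite !mxE (negbTE kn) mul0r.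
  by rewrite andTb -!val_eqE.
have fW : row_free (E *m V).
  have [V' VV'] := row_freeP fV.
  by apply/row_freeP; exists (V' *m E^T); rewrite mulmxA -(mulmxA E) VV' mulmx1.
have fixW : row l U *m projm (E *m V) = row l U.
  apply: (projm_fixes_rows UU) => //; first by lia.
  move=> k mk; apply/row_matrixP => i; rewrite row0 row_mul WE.
  apply: (eigenvectors_orthogonal AT (topV.2 _) (UA k)).
  rewrite neq_lt; apply/orP; right; apply: le_lt_trans (_ : a < _).
    apply: le_trans (nth_find 0 hasa).
    exact: eigvals_nonincr.
  rewrite ltNge; apply/negP => h.
  by have := before_find 0 (ltn_ord i); rewrite /= h.
have -> : row l U *m projm V = row l U.
  have [y ->] : exists y : 'rV_d, row l U = y *m V.
    by exists (row l U *m (E *m V)^T *m invmx (E *m V *m (E *m V)^T) *m E);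
      rewrite -[LHS]fixW /projm !mulmxA.
  by rewrite -mulmxA mulV_projm.
by rewrite enorm_row_orthogonal // expr1n mulr_ge0 // subr_ge0 ?proj_row_orthogonal_le1 // ltW.
Qed.

(** Quantitative Ky Fan principle. With a gap, $P=$ [projm V] fixes $u_l$ for $l<d$ and kills the
    other $u_l$, so $d-\mathrm{tr}(PQ)=\sum_{l\ge d}|u_lQ|^2$ is the weight [Q] puts on the lower
    eigenvectors; each unit of it costs at least the gap. *)
Lemma trace_top_gap (Q : 'M[R]_D) : Q^T = Q -> Q *m Q = Q -> \tr Q = d%:R ->
  (eigvals A)`_d < (eigvals A)`_d.-1 ->
  ((eigvals A)`_d.-1 - (eigvals A)`_d) * (d%:R - \tr (projm V *m Q)) <=
  \tr (A *m projm V) - \tr (A *m Q).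
Proof.
move=> QT QQ Qd; have [sz [U UU UA]] := orthonormal_eigenbasis AT.
have PT := trmx_projm V; have PP := projmK fV; have Pd := mxtrace_projm fV.
set lam := eigvals A in sz UA *; set a := lam`_d.-1; set b := lam`_d => ba.
have Vperp (l : 'I_D) : (d <= l)%N -> V *m (row l U)^T = 0.
  move=> dl; apply/row_matrixP => i; rewrite row0 row_mul.
  apply: (eigenvectors_orthogonal AT (topV.2 i) (UA l)).
  rewrite neq_lt; apply/orP; right; apply: (@le_lt_trans _ _ b).
    exact: eigvals_nonincr.
  by apply: (lt_le_trans ba); apply: eigvals_nonincr => //; have := ltn_ord i; lia.
have P1 (l : 'I_D) : (l < d)%N -> row l U *m projm V = row l U.
  exact: projm_fixes_rows.
have P0 (l : 'I_D) : (d <= l)%N -> row l U *m projm V = 0.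
  by move=> /Vperp/projm_perp.
pose q (l : 'I_D) := enorm (row l U *m Q) ^+ 2.
have PQ : \tr (projm V *m Q) = \sum_(l < D) (l < d)%N%:R * q l.
  rewrite (mxtrace_basis UU); apply: eq_bigr => l _; rewrite mulmxA /q.
  case: ltnP => ld; first by rewrite P1 // mul1r sqr_enorm_proj.
  by rewrite P0 // !mul0mx mul0r mxE.
rewrite !(trace_eigenbasis UU UA) //.
have -> : \sum_(l < D) lam`_l * enorm (row l U *m projm V) ^+ 2 -
    \sum_(l < D) lam`_l * enorm (row l U *m Q) ^+ 2 =
  \sum_(l < D) (lam`_l - a) * (enorm (row l U *m projm V) ^+ 2 -
     enorm (row l U *m Q) ^+ 2) + a * (\tr (projm V) - \tr Q).
  rewrite -!(sum_sqr_enorm_proj UU) // -!sumrB mulr_sumr -big_split.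
  by apply: eq_bigr => l _ /=; ring.
rewrite Pd Qd subrr mulr0 addr0 PQ -Qd -(sum_sqr_enorm_proj UU) // -sumrB mulr_sumr.
apply: ler_sum => l _; rewrite -/(q l).
case: ltnP => ld.
  rewrite mul1r subrr mulr0 P1 // enorm_row_orthogonal // expr1n mulr_ge0 //.
    by rewrite subr_ge0; apply: eigvals_nonincr => //; lia.
  by rewrite subr_ge0 proj_row_orthogonal_le1.
rewrite mul0r subr0 P0 // enorm0 expr0n sub0r mulrN -mulNr opprB.
rewrite ler_wpM2r ?sqr_ge0 // lerD2l lerN2.
exact: eigvals_nonincr.
Qed.

End rayleigh.

(** Let $P,Q$ be the two projections. [trace_top_gap] for [A] and Ky Fan's principle for [B] give
    $\mathrm{gap}\cdot(d-\mathrm{tr}(PQ))\le\mathrm{tr}((A-B)(P-Q))\le\|A-B\|_F\|P-Q\|_F$, while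
    $\|P-Q\|_F^2=2(d-\mathrm{tr}(PQ))$. Only the gap of [A] enters, so [B] may have ties. *)
Lemma davis_kahan (R : realType) (d D : nat) (A B : 'M[R]_D)
    (V W : 'M[R]_(d, D)) : (0 < d)%N -> (d <= D)%N -> A^T = A -> B^T = B ->
  top_eigenvectors A V -> top_eigenvectors B W ->
  (eigvals A)`_d < (eigvals A)`_d.-1 ->
  ((eigvals A)`_d.-1 - (eigvals A)`_d) * frob (projm V - projm W) <=
    2 * frob (A - B).
Proof.
move=> d0 dD AT BT tV tW gap.
have fV : row_free V by case: tV.
have fW : row_free W by case: tW.
have PT := trmx_projm V; have PP := projmK fV; have Pd := mxtrace_projm fV.
have QT := trmx_projm W; have QQ := projmK fW; have Qd := mxtrace_projm fW.
have h1 := trace_top_gap d0 dD AT tV QT QQ Qd gap.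
have h2 := trace_top_max d0 dD BT tW PT PP Pd.
set P := projm V in PT PP Pd h1 h2 *; set Q := projm W in QT QQ Qd h1 h2 *.
have h3 := trace_mul_le (A - B) (P - Q).
have [F0|F0] := eqVneq (frob (P - Q)) 0.
  by rewrite F0 mulr0 mulr_ge0 ?frob_ge0.
rewrite -(ler_pM2r (_ : 0 < frob (P - Q))); last by rewrite lt_def F0 frob_ge0.
rewrite -mulrA -expr2 sqr_frob.
have -> : (P - Q)^T = P - Q by rewrite linearB /= PT QT.
have -> : \tr ((P - Q) *m (P - Q)) = 2 * (d%:R - \tr (P *m Q)).
  rewrite mulmxBl !mulmxBr PP QQ !linearB /= Pd Qd (mxtrace_mulC Q P); ring.
move: h3; rewrite linearB /= PT QT mulmxBl !mulmxBr !linearB /= => h3.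
by move: h1 h2 h3; lra.
Qed.

(** * The hyperbolic cosine of the norm of a sum *)

Section cosh.
Context {R : realType}.
Implicit Types a b c u x y : R.

Definition cosh x : R := (expR x + expR (- x)) / 2.
Definition sinh x : R := (expR x - expR (- x)) / 2.

(** Induction on [m]: the step leaves the defect $t(1-t)(x-y)(x^m-y^m)$, which is nonnegative by
    monotonicity. *)
Lemma exprn_convex (m : nat) (t x y : R) : 0 <= t <= 1 -> 0 <= x -> 0 <= y ->
  (t * x + (1 - t) * y) ^+ m <= t * x ^+ m + (1 - t) * y ^+ m.
Proof.
move=> /andP[t0 t1] x0 y0; elim: m => [|m IH]; first by rewrite !expr0; lra.
have z0 : 0 <= t * x + (1 - t) * y by rewrite addr_ge0 ?mulr_ge0 ?subr_ge0.
rewrite !exprS; apply: le_trans (ler_wpM2l z0 IH) _.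
have : 0 <= (x - y) * (x ^+ m - y ^+ m).
  have [xy|/ltW yx] := leP x y.
    by rewrite mulr_le0 // subr_le0 // lerXn2r.
  by rewrite mulr_ge0 // subr_ge0 // lerXn2r.
move=> h; have : 0 <= t * (1 - t) * ((x - y) * (x ^+ m - y ^+ m)).
  by rewrite mulr_ge0 // mulr_ge0 // subr_ge0.
by lra.
Qed.

Lemma cvg_series_expR x : series (exp_coeff x) @ \oo --> expR x.
Proof. exact: is_cvg_series_exp_coeff. Qed.

Lemma cvg_series_cosh x :
  (fun n => (series (exp_coeff x) n + series (exp_coeff (- x)) n) / 2) @ \oo
    --> cosh x.
Proof.
apply: cvgMl; apply: cvgD; exact: cvg_series_expR.
Qed.

(* cosh (sqrt y) is a convex function of y, since its power series in y has
   nonnegative coefficients. *)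
Lemma cosh_law_of_cosines a b c u : -1 <= u <= 1 ->
  c ^+ 2 = a ^+ 2 + b ^+ 2 + 2 * a * b * u ->
  cosh c <= (1 + u) / 2 * cosh (a + b) + (1 - u) / 2 * cosh (a - b).
Proof.
move=> /andP[u0 u1] cE.
pose S (x : R) n := (series (exp_coeff x) n + series (exp_coeff (- x)) n) / 2.
have cvr : (fun n => (1 + u) / 2 * S (a + b) n + (1 - u) / 2 * S (a - b) n) @ \oo
    --> (1 + u) / 2 * cosh (a + b) + (1 - u) / 2 * cosh (a - b).
  by apply: cvgD; (apply: cvgM; [exact: cvg_cst|exact: cvg_series_cosh]).
apply: (ler_cvg_to (@cvg_series_cosh c) cvr).
apply: nearW => n; rewrite /S /series /= -!big_split /= !mulr_suml !mulr_sumr -big_split /=.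
apply: ler_sum => k _; rewrite /exp_coeff /=.
have f0 : 0 <= (k`!%:R : R)^-1 by rewrite invr_ge0.
suff key : c ^+ k + (- c) ^+ k <=
    (1 + u) / 2 * ((a + b) ^+ k + (- (a + b)) ^+ k) +
    (1 - u) / 2 * ((a - b) ^+ k + (- (a - b)) ^+ k).
  move: f0 (ler_wpM2r f0 key); move: (k`!%:R)^-1 => f f0.
  by rewrite !mulrDl -!mulrA !mulrDl; lra.
(* Odd powers cancel. For even ones, $c^2$ is the convex combination of $(a+b)^2$ and $(a-b)^2$ with
   weights $(1\pm u)/2$. *)
have [m [->|->]] : exists m, k = m.*2 \/ k = m.*2.+1.
  exists k./2; have := odd_double_half k.
  by case: (odd k); rewrite ?add0n ?add1n; [right|left].
- have E (x : R) : x ^+ m.*2 + (- x) ^+ m.*2 = 2 * (x ^+ 2) ^+ m.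
    by rewrite -mul2n !exprM sqrrN; ring.
  rewrite !E; have := @exprn_convex m ((1 + u) / 2) ((a + b) ^+ 2) ((a - b) ^+ 2).
  have -> : (1 + u) / 2 * (a + b) ^+ 2 + (1 - (1 + u) / 2) * (a - b) ^+ 2 = c ^+ 2.
    by rewrite cE; field.
  have -> : 1 - (1 + u) / 2 = (1 - u) / 2 :> R by field.
  move=> /(_ _ (sqr_ge0 _) (sqr_ge0 _)) h.
  have /h : 0 <= (1 + u) / 2 <= 1 by lra.
  by lra.
- have E (x : R) : x ^+ m.*2.+1 + (- x) ^+ m.*2.+1 = 0.
    by rewrite exprNn -signr_odd /= odd_double /= expr1 mulN1r subrr.
  by rewrite !E !mulr0 addr0.
Qed.

(** From $e^{-x/2}\ge1-x/2$ follows $e^x\le(1-x/2)^{-2}$; the rest is a polynomial inequality on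
    $[-1,1]$. *)
Lemma expR_le_quad x : `|x| <= 1 -> expR x <= 1 + x + 2 * x ^+ 2.
Proof.
rewrite ler_norml => /andP[x0 x1].
have h : 1 - x / 2 <= expR (- (x / 2)) by exact: expR_ge1Dx.
have h0 : 0 < 1 - x / 2 by lra.
have E : expR x * expR (- (x / 2)) ^+ 2 = 1.
  by rewrite expr2 -!expRD (_ : x + _ = 0) ?expR0 //; field.
have h2 : (1 - x / 2) ^+ 2 <= expR (- (x / 2)) ^+ 2.
  by rewrite ler_pXn2r ?nnegrE ?expR_ge0 // ltW.
have h3 : expR x * (1 - x / 2) ^+ 2 <= 1.
  by rewrite -[leRHS]E ler_pM2l ?expR_gt0 //.
rewrite -(ler_pM2r (_ : 0 < (1 - x / 2) ^+ 2)) ?exprn_gt0 //.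
apply: (le_trans h3).
have -> : (1 + x + 2 * x ^+ 2) * (1 - x / 2) ^+ 2 =
  1 + x ^+ 2 * ((1 - x) * (5 / 2 - x) / 2) by field.
by rewrite lerDl mulr_ge0 ?sqr_ge0 // divr_ge0 // mulr_ge0; lra.
Qed.

Lemma cosh_ge1 x : 1 <= cosh x.
Proof. by have := expR_ge1Dx x; have := expR_ge1Dx (- x); rewrite /cosh; lra. Qed.

Lemma cosh_ge_half_expR x : expR x / 2 <= cosh x.
Proof. by have := expR_ge0 (- x); rewrite /cosh; lra. Qed.

Lemma sinh_ge0 x : 0 <= x -> 0 <= sinh x.
Proof.
by move=> x0; rewrite /sinh divr_ge0 // subr_ge0 ler_expR ge0_cp.
Qed.

Lemma sinh_le_cosh x : sinh x <= cosh x.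
Proof. by have := expR_ge0 (- x); rewrite /cosh /sinh; lra. Qed.

(* Pinelis' inequality; the gradient of x |-> cosh |x| is (sinh |x| / |x|) x. *)
Lemma cosh_vnorm_add (I : finType) (x z : I -> R) : vnorm z <= 1 ->
  cosh (vnorm (fun i => x i + z i)) <=
    cosh (vnorm x) * (1 + 3 * vnorm z ^+ 2) +
    \sum_i sinh (vnorm x) / vnorm x * x i * z i.
Proof.
move=> z1; set a := vnorm x; set b := vnorm z; set c := vnorm _.
have a0 : 0 <= a := vnorm_ge0 _; have b0 : 0 <= b := vnorm_ge0 _.
have b1 : `|b| <= 1 by rewrite ger0_norm.
have q1 := expR_le_quad b1; have q2 : expR (- b) <= 1 - b + 2 * b ^+ 2.
  by rewrite (le_trans (expR_le_quad _)) ?normrN // sqrrN.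
have q3 := expR_ge1Dx b; have q4 := expR_ge1Dx (- b).
have chb : cosh b <= 1 + 2 * b ^+ 2 by rewrite /cosh; lra.
have shb : `|sinh b - b| <= b ^+ 2 by rewrite ler_norml /sinh; lra.
have cha := cosh_ge1 a.
set s := \sum_i x i * z i.
have -> : \sum_i sinh a / a * x i * z i = sinh a / a * s.
  by rewrite mulr_sumr; apply: eq_bigr => i _; rewrite mulrA.
have csq : c ^+ 2 = a ^+ 2 + b ^+ 2 + 2 * s.
  by rewrite !sqr_vnorm /s mulr_sumr -!big_split; apply: eq_bigr => i _ /=; ring.
have sle : `|s| <= a * b by exact: cauchy_schwarz.
(* Zero vectors are set apart since they make no angle; the linear term vanishes for them. *)
have [a_eq0|a_neq0] := eqVneq a 0.
  have s0 : s = 0 by apply/normr0_eq0/le_anti; rewrite normr_ge0 (le_trans sle) ?a_eq0 ?mul0r.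
  have -> : c = b.
    apply/eqP; rewrite -(@eqrXn2 _ 2) ?vnorm_ge0 // csq a_eq0 s0.
    by rewrite expr0n mulr0 add0r addr0.
  have : 1 * (1 + 3 * b ^+ 2) <= cosh a * (1 + 3 * b ^+ 2).
    by rewrite ler_wpM2r // addr_ge0 // mulr_ge0 ?sqr_ge0.
  by rewrite s0 mulr0 addr0; have := sqr_ge0 b; lra.
have [b_eq0|b_neq0] := eqVneq b 0.
  have s0 : s = 0 by apply/normr0_eq0/le_anti; rewrite normr_ge0 (le_trans sle) ?b_eq0 ?mulr0.
  have -> : c = a.
    apply/eqP; rewrite -(@eqrXn2 _ 2) ?vnorm_ge0 // csq b_eq0 s0.
    by rewrite expr0n mulr0 !addr0.
  by rewrite s0 b_eq0 expr0n !mulr0 !addr0 mulr1.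
have agt0 : 0 < a by rewrite lt_def a_neq0.
have bgt0 : 0 < b by rewrite lt_def b_neq0.
(* The cosine of the angle between [x] and [z]. *)
pose u := s / (a * b).
have sE : s = u * (a * b) by rewrite /u; field; rewrite a_neq0 b_neq0.
have u1 : -1 <= u <= 1.
  have ab0 : 0 < a * b by rewrite mulr_gt0.
  by rewrite -ler_norml /u normrM normfV [`|a * b|]gtr0_norm // ler_pdivrMr // mul1r.
have cE : c ^+ 2 = a ^+ 2 + b ^+ 2 + 2 * a * b * u by rewrite csq sE; ring.
apply: le_trans (cosh_law_of_cosines u1 cE) _.
have -> : (1 + u) / 2 * cosh (a + b) + (1 - u) / 2 * cosh (a - b) =
    cosh a * cosh b + u * (sinh a * sinh b).
  by rewrite /cosh /sinh opprD opprB (addrC b) !expRD; field.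
(* The first-order term is split off. The remainder $\sinh b-b$ is at most $b^2$ in absolute value,
   which with $\cosh b\le1+2b^2$ gives the constant 3. *)
have -> : u * (sinh a * sinh b) = sinh a / a * s + sinh a * (u * (sinh b - b)).
  by rewrite sE; field.
rewrite addrCA addrC lerD2r.
have sha := sinh_ge0 a0; have shca := sinh_le_cosh a.
have h : u * (sinh b - b) <= b ^+ 2.
  apply: le_trans (ler_norm _) _; rewrite normrM -[leRHS]mul1r.
  by rewrite ler_pM // ler_norml.
have h1 : sinh a * (u * (sinh b - b)) <= sinh a * b ^+ 2 by rewrite ler_wpM2l.
have h2 : sinh a * b ^+ 2 <= cosh a * b ^+ 2 by rewrite ler_wpM2r ?sqr_ge0.
have h3 : cosh a * cosh b <= cosh a * (1 + 2 * b ^+ 2).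
  by rewrite ler_wpM2l // (le_trans ler01).
by lra.
Qed.

End cosh.

(** * Independence of a sample from the earlier ones *)

Section independence.
Context {R : realType} d d' (Omega : measurableType d) (T : measurableType d').
Variables (P : probability Omega R) (rho : probability T R) (n : nat).
Variable X : 'I_n -> {mfun Omega >-> T}.
Hypothesis iidX : forall B : 'I_n -> set T, (forall i, measurable (B i)) ->
  P (\bigcap_(i in [set: 'I_n]) (X i @^-1` B i)) = (\prod_(i < n) rho (B i))%E.

(* A pi-system generating the sigma-algebra of the samples before the m-th. *)
Definition past (m : nat) : set (set Omega) :=
  [set A | exists B : 'I_n -> set T, [/\ forall i, measurable (B i),
     forall i : 'I_n, (m <= i)%N -> B i = setT &
     A = \bigcap_(i in [set: 'I_n]) (X i @^-1` B i)]].

Lemma measurable_past m : past m `<=` measurable.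
Proof.
move=> _ [B [mB _ ->]]; apply: fin_bigcap_measurable => // i _.
by rewrite -[X in measurable X]setTI; exact: measurable_funP.
Qed.

Lemma measurable_sigma_past m : <<s past m >> `<=` measurable.
Proof. by apply: smallest_sub; [exact: sigma_algebra_measurable|exact: measurable_past]. Qed.

Lemma past_setT m : past m setT.
Proof.
exists (fun=> setT); split => //; apply/seteqP; split => // w _ i _ //.
Qed.

Lemma past_setI m : setI_closed (past m).
Proof.
move=> _ _ [B [mB Bm ->]] [C [mC Cm ->]]; exists (fun i => B i `&` C i); split.
- by move=> i; apply: measurableI.
- by move=> i mi; rewrite Bm // Cm // setTI.
- by apply/seteqP; split => w /=; [move=> [h1 h2] i _; split; [exact: h1|exact: h2]|
    move=> h; split => i _; have [] := h i I].
Qed.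

(** The restriction of [P] to the event $X_j\in C$ and the multiple $\rho(C)P$ agree on the
    pi-system [past j], hence on the sigma-algebra it generates. *)
Lemma past_independent (j : 'I_n) A C : <<s past j >> A -> measurable C ->
  P (A `&` X j @^-1` C) = (P A * rho C)%E.
Proof.
move=> sA mC.
have mXC : measurable (X j @^-1` C).
  by rewrite -[X in measurable X]setTI; exact: measurable_funP.
pose r : {nonneg R} := NngNum (fine_ge0 (measure_ge0 rho C)).
have rE : (r%:num)%:E = rho C by rewrite fineK // fin_num_measure.
have mscE B : mscale r P B = (P B * rho C)%E by rewrite /mscale rE muleC.
rewrite -mscE; apply: (@g_sigma_algebra_measure_unique _ R Omega (past j)
  (@measurable_past j) (fun=> setT) (fun=> past_setT j) _ (mrestr P mXC)
  (mscale r P) (@past_setI j)) => //.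
- by rewrite bigcup_const.
- move=> _ [B [mB Bj ->]]; apply: (eq_trans _ (esym (mscE _))); rewrite /= /mrestr.
  (* Slot [j] of a past event is free, so [C] can be put there and the product rule applied to a
     single family. *)
  pose B' i := if i == j then C else B i.
  have -> : \bigcap_(i in [set: 'I_n]) (X i @^-1` B i) `&` X j @^-1` C =
      \bigcap_(i in [set: 'I_n]) (X i @^-1` B' i).
    apply/seteqP; split => w /=.
      by move=> [h1 h2] i _; rewrite /B'; case: eqP => [->|_] //; exact: h1.
    move=> h; split; last by have := h j I; rewrite /B' eqxx.
    move=> i _; have := h i I; rewrite /B'; case: eqP => [->|_] // _.
    by rewrite Bj.
  rewrite !iidX // => [|i]; last by rewrite /B'; case: eqP.
  rewrite (bigD1 j) //= {1}/B' eqxx [in RHS](bigD1 j) //= Bj //.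
  rewrite probability_setT mul1e muleC; congr (_ * _)%E.
  by apply: eq_bigr => i /negbTE ij; rewrite /B' ij.
- move=> _; apply: (@le_lt_trans _ _ (P setT)); last by rewrite probability_setT ltry.
  by apply: le_measure; rewrite ?inE //; apply: measurableI.
Qed.

(** The points of [Omega] with a coarser sigma-algebra: measurability with respect to the past
    becomes a matter of type. *)
Definition pastT m : measurableType (past m).-sigma := g_sigma_algebraType (past m).

Lemma measurable_fun_past m d'' (U : measurableType d'') (f : Omega -> U) :
  measurable_fun [set: pastT m] f -> measurable_fun [set: Omega] f.
Proof. by move=> mf _ B mB; exact: (@measurable_sigma_past m _ (mf measurableT B mB)). Qed.

Lemma measurable_past_sample m (i : 'I_n) : (i < m)%N ->
  measurable_fun setT (X i : pastT m -> T).
Proof.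
move=> im _ B mB; rewrite setTI; apply: sub_sigma_algebra.
exists (fun k => if k == i then B else setT); split.
- by move=> k; case: eqP.
- by move=> k mk; case: eqP => // ki; move: mk; rewrite ki; lia.
- apply/seteqP; split => w /=; last by move=> /(_ i I); rewrite eqxx.
  by move=> h k _; case: eqP => [->|].
Qed.

(** The pair formed by the past and [X j] has a product law, so Tonelli's theorem integrates [X j]
    out. This replaces conditional expectation. *)
Lemma integral_past_sample (j : 'I_n)
    (f : pastT j * T -> \bar R) :
  measurable_fun setT f -> (forall x, 0 <= f x)%E ->
  (\int[P]_w f (w, X j w) = \int[P]_w \int[rho]_x f (w, x))%E.
Proof.
move=> mf f0.
have mid : measurable_fun setT (id : Omega -> pastT j).
  move=> _ B mB; rewrite setTI; exact: (@measurable_sigma_past j B mB).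
pose idm : {mfun Omega >-> pastT j} :=
  HB.pack (id : Omega -> pastT j)
    (isMeasurableFun.Build _ _ _ _ _ mid).
have mY : measurable_fun setT
    (fun w => (w, X j w) : (pastT j * T)%type).
  by apply: measurable_fun_pair => //; exact: measurable_funP.
pose Y : {mfun Omega >-> (pastT j * T)%type} :=
  HB.pack (fun w => (w, X j w) : (pastT j * T)%type)
    (isMeasurableFun.Build _ _ _ _ _ mY).
have YE : forall A, measurable A ->
    (distribution P idm \x rho)%E A = distribution P Y A.
  apply: product_measure_unique => A B mA mB.
  rewrite /distribution /pushforward /=.
  rewrite -(past_independent mA mB); congr (P _).
transitivity (\int[distribution P Y]_z f z)%E.
  by rewrite ge0_integral_distribution.
transitivity (\int[distribution P idm \x rho]_z f z)%E.
  by apply: eq_measure_integral => A mA _; apply/esym; exact: YE.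
rewrite fubini_tonelli1 // ge0_integral_distribution //.
- exact: measurable_fun_fubini_tonelli_F.
- by move=> w; apply: integral_ge0 => x _.
Qed.

End independence.

(** * Dimension-free concentration of sums of bounded vectors *)

Lemma measurable_vnorm d (T : measurableType d) (R : realType) (I : finType)
    (f : T -> I -> R) : (forall i, measurable_fun setT (fun x => f x i)) ->
  measurable_fun setT (fun x => vnorm (f x)).
Proof.
move=> mf; rewrite /vnorm.
apply: (@measurableT_comp _ _ _ _ _ _ (@Num.sqrt R)).
  by apply: continuous_measurable_fun; exact: sqrt_continuous.
by apply: measurable_sum => i; exact: measurable_funX.
Qed.

Lemma measurable_cosh (R : realType) : measurable_fun setT (@cosh R).
Proof.
apply: measurable_funM => //; apply: measurable_funD => //.
exact: measurableT_comp.
Qed.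

Lemma bounded_integrable d (T : measurableType d) (R : realType)
    (mu : probability T R) (f : T -> R) (M : R) :
  measurable_fun setT f -> (forall x, `|f x| <= M) ->
  mu.-integrable setT (EFin \o f).
Proof.
move=> mf fM; apply: measurable_bounded_integrable => //.
  by apply: le_lt_trans (ltry 1); rewrite -(probability_setT mu).
exists M; split; first exact: num_real.
by move=> y My x _; exact: le_trans (fM x) (ltW My).
Qed.

Lemma integral_cst_prob d (T : measurableType d) (R : realType)
    (mu : probability T R) (c : R) : (\int[mu]_x c%:E = c%:E)%E.
Proof.
rewrite integral_cst // (_ : _ [set: T] = 1%E) ?mule1 //.
exact: (probability_setT mu).
Qed.

Section concentration.
Context {R : realType} d d' (Omega : measurableType d) (T : measurableType d').
Variables (P : probability Omega R) (rho : probability T R) (n : nat).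
Variable X : 'I_n -> {mfun Omega >-> T}.
Hypothesis iidX : forall B : 'I_n -> set T, (forall i, measurable (B i)) ->
  P (\bigcap_(i in [set: 'I_n]) (X i @^-1` B i)) = (\prod_(i < n) rho (B i))%E.
Context (I : finType) (phi : T -> I -> R) (p : R).
Hypothesis mphi : forall i, measurable_fun setT (fun x => phi x i).
Hypothesis phi1 : forall x, vnorm (phi x) <= 1.
Hypothesis phi0 : forall i, (\int[rho]_x (phi x i)%:E = 0)%E.
Hypothesis phi2 : (\int[rho]_x (vnorm (phi x) ^+ 2)%:E <= p%:E)%E.

Let phi_le1 x i : `|phi x i| <= 1.
Proof.
apply: le_trans (phi1 x).
rewrite -(@ler_pXn2r _ 2) ?nnegrE ?vnorm_ge0 // real_normK ?num_real //.
rewrite sqr_vnorm (bigD1 i) //= lerDl.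
by apply: sumr_ge0 => j _; exact: sqr_ge0.
Qed.

Let integral_affine (c0 c1 : R) (g : I -> R) :
  (\int[rho]_x (c0 + c1 * vnorm (phi x) ^+ 2 + \sum_i g i * phi x i)%:E =
   (c0%:E + c1%:E * \int[rho]_x (vnorm (phi x) ^+ 2)%:E))%E.
Proof.
have i0 : rho.-integrable setT (EFin \o (fun=> c0)).
  by apply: (@bounded_integrable _ _ _ _ _ `|c0|).
have i1 : rho.-integrable setT (EFin \o (fun x => vnorm (phi x) ^+ 2)).
  apply: (@bounded_integrable _ _ _ _ _ 1).
    by apply: measurable_funX; exact: measurable_vnorm.
  by move=> x; rewrite ger0_norm ?sqr_ge0 // exprn_ile1 ?vnorm_ge0.
have ip i : rho.-integrable setT (EFin \o (fun x => phi x i)).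
  exact: (@bounded_integrable _ _ _ _ _ 1).
have i1' := integrableZl measurableT c1 i1.
have ip' i := integrableZl measurableT (g i) (ip i).
have isum : rho.-integrable setT
    (fun x => \sum_i (g i)%:E * (EFin \o (fun x => phi x i)) x)%E.
  by apply: integrable_sum.
transitivity (\int[rho]_x ((EFin \o (fun=> c0)) x +
   (c1%:E * (EFin \o (fun x => (vnorm (phi x) ^+ 2)%R)) x +
   \sum_i (g i)%:E * (EFin \o (fun x => phi x i)) x)))%E.
  by apply: eq_integral => x _ /=; rewrite -addrA !EFinD EFinM -sumEFin.
rewrite integralD //; last exact: integrableD.
congr (_ + _)%E; first exact: integral_cst_prob.
rewrite integralD // integralZl // integral_sum //.
rewrite big1 ?adde0 // => i _.
by rewrite integralZl //= phi0 mule0.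
Qed.

(** Effect of one new sample: in [cosh_vnorm_add], scaled by [lam], the linear term has mean 0 and
    the squared norm has mean at most [p]. *)
Lemma pinelis_step (lam : R) (s : I -> R) : 0 <= lam <= 1 ->
  (\int[rho]_x (cosh (lam * vnorm (fun i => (s i + phi x i)%R)))%:E <=
   (cosh (lam * vnorm s) * (1 + 3 * lam ^+ 2 * p))%:E)%E.
Proof.
move=> /andP[l0 l1]; set C := cosh (lam * vnorm s).
pose g i := sinh (lam * vnorm s) / (lam * vnorm s) * (lam * s i) * lam.
have C0 : 0 <= C by rewrite (le_trans ler01) ?cosh_ge1.
have le1 x : cosh (lam * vnorm (fun i => s i + phi x i)) <=
    C + C * 3 * lam ^+ 2 * vnorm (phi x) ^+ 2 + \sum_i g i * phi x i.
  have vE (a : I -> R) : lam * vnorm a = vnorm (fun i => lam * a i).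
    by rewrite vnormZ ger0_norm.
  have h1 : vnorm (fun i => lam * phi x i) <= 1.
    by rewrite -vE mulr_ile1 ?vnorm_ge0.
  rewrite vE (@eq_vnorm _ _ _ (fun i => lam * s i + lam * phi x i)); last first.
    by move=> i; rewrite mulrDr.
  apply: le_trans (cosh_vnorm_add (fun i => lam * s i) h1) _.
  rewrite -!vE -/C exprMn.
  have -> : \sum_i sinh (lam * vnorm s) / (lam * vnorm s) * (lam * s i) *
     (lam * phi x i) = \sum_i g i * phi x i.
    by apply: eq_bigr => i _; rewrite /g; ring.
  by rewrite lerD2r; lra.
have mE : measurable_fun setT
    (fun x => (cosh (lam * vnorm (fun i => (s i + phi x i)%R)))%:E).
  apply/measurable_EFinP; apply: (measurableT_comp (@measurable_cosh R)).
  apply: measurable_funM => //; apply: measurable_vnorm => i.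
  exact: measurable_funD.
apply: (@le_trans _ _ (\int[rho]_x (C + C * 3 * lam ^+ 2 * vnorm (phi x) ^+ 2 +
      \sum_i g i * phi x i)%:E)%E).
  apply: ge0_le_integral => //.
  - by move=> x _; rewrite lee_fin (le_trans ler01) ?cosh_ge1.
  - apply/measurable_EFinP; apply: measurable_funD.
      apply: measurable_funD => //; apply: measurable_funM => //.
      by apply: measurable_funX; exact: measurable_vnorm.
    by apply: measurable_sum => i; exact: measurable_funM.
  - by move=> x _; rewrite lee_fin.
rewrite integral_affine.
apply: (@le_trans _ _ (C%:E + (C * 3 * lam ^+ 2)%:E * p%:E)%E).
  by rewrite leeD2l // lee_wpmul2l // lee_fin !mulr_ge0 ?sqr_ge0.
by rewrite -EFinM -EFinD lee_fin; lra.
Qed.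

Definition partial_sum (m : nat) (w : Omega) (i : I) : R :=
  \sum_(k < n | (k < m)%N) phi (X k w) i.

(** Induction on the number of samples: given the past, the next one costs a factor at most
    $1+3\lambda^2p$. *)
Lemma cosh_moment (lam : R) m : 0 <= lam <= 1 -> 0 <= p -> (m <= n)%N ->
  (\int[P]_w (cosh (lam * vnorm (partial_sum m w)))%:E <=
   ((1 + 3 * lam ^+ 2 * p) ^+ m)%:E)%E.
Proof.
move=> l01 p0; elim: m => [_|m IH mn].
  rewrite (eq_integral (fun=> 1%E)) => [|w _].
    by rewrite integral_cst_prob expr0.
  rewrite (@eq_vnorm _ _ _ (fun=> 0)) => [|i].
    by rewrite vnorm0 mulr0 /cosh oppr0 expR0 -mulr2n mulfV.
  by rewrite /partial_sum big_pred0.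
pose j := Ordinal mn.
have sumS w i : partial_sum m.+1 w i = partial_sum m w i + phi (X j w) i.
  rewrite /partial_sum (bigD1 j) //= addrC; congr (_ + _).
  apply: eq_bigl => k; rewrite ltnS leq_eqVlt -(inj_eq val_inj) /=.
  by case: ltngtP.
pose F (z : pastT X j * T) :=
  (cosh (lam * vnorm (fun i => partial_sum m z.1 i + phi z.2 i)))%:E.
have mS i : measurable_fun setT (fun w : pastT X j => partial_sum m w i).
  under eq_fun do rewrite /partial_sum big_mkcond /=.
  apply: measurable_sum => k; case: (boolP (k < m)%N) => km //.
  by apply: (measurableT_comp (mphi i)); exact: measurable_past_sample.
have mF : measurable_fun setT F.
  apply/measurable_EFinP; apply: (measurableT_comp (@measurable_cosh R)).
  apply: measurable_funM => //; apply: measurable_vnorm => i.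
  by apply: measurable_funD;
    [exact: (measurableT_comp (mS i))|exact: (measurableT_comp (mphi i))].
have F0 z : (0 <= F z)%E by rewrite lee_fin (le_trans ler01) ?cosh_ge1.
have mS' i : measurable_fun setT (fun w : Omega => partial_sum m w i).
  under eq_fun do rewrite /partial_sum big_mkcond /=.
  apply: measurable_sum => k; case: (boolP (k < m)%N) => km //.
  by apply: (measurableT_comp (mphi i)); exact: measurable_funP.
have mC : measurable_fun setT
    (fun w : Omega => (cosh (lam * vnorm (partial_sum m w)))%:E).
  apply/measurable_EFinP; apply: (measurableT_comp (@measurable_cosh R)).
  by apply: measurable_funM => //; apply: measurable_vnorm.
pose kap := 1 + 3 * lam ^+ 2 * p.
have kap0 : 0 <= kap by rewrite /kap addr_ge0 // mulr_ge0 // mulr_ge0 ?sqr_ge0.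
have -> : (\int[P]_w (cosh (lam * vnorm (partial_sum m.+1 w)))%:E =
    \int[P]_w F (w, X j w))%E.
  apply: eq_integral => w _; congr (cosh (_ * _))%:E.
  by apply: eq_vnorm => i; exact: sumS.
rewrite (integral_past_sample iidX mF F0).
apply: (@le_trans _ _ (\int[P]_w (kap%:E *
   (cosh (lam * vnorm (partial_sum m w)))%:E))%E).
  apply: ge0_le_integral => //.
  - by move=> w _; apply: integral_ge0 => x _.
  - apply: (@measurable_fun_past _ _ _ _ _ X j _ _ (fun w => \int[rho]_x F (w, x))%E).
    exact: measurable_fun_fubini_tonelli_F.
  - exact: measurable_funeM.
  - move=> w _; apply: le_trans (pinelis_step (partial_sum m w) l01) _.
    by rewrite -EFinM lee_fin mulrC.
rewrite ge0_integralZl //; last by move=> w _; rewrite lee_fin (le_trans ler01) ?cosh_ge1.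
by rewrite exprS EFinM lee_wpmul2l ?lee_fin // IH // ltnW.
Qed.

Definition sample_sum (w : Omega) (i : I) : R := \sum_(k < n) phi (X k w) i.

Lemma measurable_deviation (t : R) :
  measurable [set w | t <= vnorm (sample_sum w)].
Proof.
have mv : measurable_fun setT (fun w => vnorm (sample_sum w)).
  apply: measurable_vnorm => i; apply: measurable_sum => k.
  by apply: (measurableT_comp (mphi i)); exact: measurable_funP.
rewrite (_ : [set _ | _] = (fun w => vnorm (sample_sum w)) @^-1` `[t, +oo[).
  by rewrite -[X in measurable X]setTI; exact: mv.
by apply/seteqP; split => w /=; rewrite in_itv /= andbT.
Qed.

(** Markov's inequality for $\cosh(\lambda|S|)\ge e^{\lambda|S|}/2$, whence the factor 2. The upper
    bound on [t] keeps [lam] at most 1. *)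
Lemma deviation_bound (t : R) : 0 < p -> (0 < n)%N ->
  0 <= t <= 6 * n%:R * p ->
  (P [set w | (t <= vnorm (sample_sum w))%R] <=
   (2 * expR (- (t ^+ 2 / (12 * n%:R * p))))%:E)%E.
Proof.
move=> p0 n0 /andP[t0 tle]; set A := [set _ | _].
have mA : measurable A by exact: measurable_deviation.
have np0 : 0 < 6 * n%:R * p by rewrite !mulr_gt0 ?ltr0n.
(* The minimiser of the exponent $3n\lambda^2p-\lambda t$. *)
pose lam := t / (6 * n%:R * p).
have l01 : 0 <= lam <= 1.
  by rewrite /lam divr_ge0 ?(ltW np0) //= ler_pdivrMr // mul1r.
have := cosh_moment l01 (ltW p0) (leqnn n).
have -> : (\int[P]_w (cosh (lam * vnorm (partial_sum n w)))%:E =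
    \int[P]_w (cosh (lam * vnorm (sample_sum w)))%:E)%E.
  apply: eq_integral => w _; congr (cosh (_ * _))%:E; apply: eq_vnorm => i.
  by apply: eq_bigl => k; rewrite ltn_ord.
set K := (1 + _) ^+ n => hK.
have mv : measurable_fun setT (fun w => (cosh (lam * vnorm (sample_sum w)))%:E).
  apply/measurable_EFinP; apply: (measurableT_comp (@measurable_cosh R)).
  apply: measurable_funM => //.
  apply: measurable_vnorm => i; apply: measurable_sum => k.
  by apply: (measurableT_comp (mphi i)); exact: measurable_funP.
have h1 : ((expR (lam * t) / 2)%:E * P A <= K%:E)%E.
  rewrite -integral_cst //; apply: le_trans hK.
  apply: (@le_trans _ _ (\int[P]_(w in A) (cosh (lam * vnorm (sample_sum w)))%:E)%E).
    apply: ge0_le_integral => //.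
    - by move=> w _; rewrite lee_fin divr_ge0 ?expR_ge0.
    - exact: measurable_funS mv.
    - move=> w Aw; rewrite lee_fin (le_trans _ (cosh_ge_half_expR _)) //.
      rewrite ler_pM2r ?invr_gt0 // ler_expR ler_wpM2l //.
      by case/andP: l01.
  apply: ge0_subset_integral => //.
  by move=> w _; rewrite lee_fin (le_trans ler01) ?cosh_ge1.
have h2 : K <= expR (n%:R * (3 * lam ^+ 2 * p)).
  rewrite expRM_natl lerXn2r ?nnegrE ?expR_ge0 ?expR_ge1Dx //.
  by rewrite addr_ge0 // mulr_ge0 ?(ltW p0) // mulr_ge0 ?sqr_ge0.
have PAfin : P A \is a fin_num by rewrite fin_num_measure.
rewrite -(fineK PAfin) -EFinM lee_fin in h1.
rewrite -(fineK PAfin) lee_fin.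
have h3 : expR (lam * t) * fine (P A) <= 2 * expR (n%:R * (3 * lam ^+ 2 * p)).
  by move: h1 h2; lra.
have -> : - (t ^+ 2 / (12 * n%:R * p)) = n%:R * (3 * lam ^+ 2 * p) - lam * t.
  rewrite /lam; field; by rewrite pnatr_eq0 -lt0n n0 /= gt_eqF.
rewrite expRD expRN mulrA ler_pdivlMr ?expR_gt0 //.
by rewrite mulrC.
Qed.

End concentration.

(** * Normalised statistics of a cell and their measurability *)

Lemma indic_neq0 (T : Type) (R : realType) (A : set T) x : \1_A x != 0 :> R -> A x.
Proof. by rewrite indicE; case: (boolP (x \in A)) => [/set_mem|_ /eqP]. Qed.

Section cell_mean.
Context {R : realType} d (T : measurableType d) (rho : probability T R).
Variables (C E : set T).
Hypotheses (mC : measurable C) (mE : measurable E) (EC : E `<=` C).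
Hypothesis CE0 : rho (C `\` E) = 0%E.
Let p := fine (rho C).
Hypothesis p0 : 0 < p.
Context (I : finType) (h : T -> I -> R) (v : I -> R) (M : R).
Hypothesis mh : forall i, measurable_fun setT (fun x => h x i).
Hypothesis hM : forall x, E x -> vnorm (h x) <= M.
Hypothesis M0 : 0 < M.
Hypothesis vE : forall i, v i = p^-1 * \int[rho]_(x in C) h x i.

(** [E] is a part of [C] of full mass on which the bound on [h] holds at every point; integrals over
    [C] may be taken over [E]. *)
Lemma Rintegral_full_subset (f : T -> R) : measurable_fun setT f ->
  \int[rho]_(x in C) f x = \int[rho]_(x in E) f x.
Proof.
move=> mf; rewrite /Rintegral; congr fine.
rewrite integral_mkcond [RHS]integral_mkcond; apply: ae_eq_integral => //.
- by apply/(measurable_restrictT _ mC).1; apply/measurable_EFinP;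
    exact: measurable_funS mf.
- by apply/(measurable_restrictT _ mE).1; apply/measurable_EFinP;
    exact: measurable_funS mf.
exists (C `\` E); split => //; first exact: measurableD.
move=> x /= /not_implyP[_ xN]; split.
  apply: contra_notP xN => nC; rewrite !patchE; case: ifPn => [/set_mem//|_].
  by case: ifPn => [/set_mem/EC|].
move=> Ex; apply: xN; rewrite !patchE !mem_set //; exact: EC.
Qed.

Lemma fine_rhoE : fine (rho E) = p.
Proof.
rewrite /p; congr fine; rewrite -[in RHS](setDUK EC) measureU //.
- by rewrite [X in (_ + X)%E]CE0 adde0.
- exact: measurableD.
- by rewrite setDE setIC -setIA setICl setI0.
Qed.

Lemma integrable_on (f : T -> R) (K : R) : measurable_fun setT f ->
  (forall x, E x -> `|f x| <= K) -> rho.-integrable E (EFin \o f).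
Proof.
move=> mf fK; apply: measurable_bounded_integrable => //.
- by apply: (le_lt_trans (probability_le1 rho mE)); exact: ltry.
- exact: measurable_funS mf.
exists K; split; first exact: num_real.
by move=> y Ky x Ex; exact: le_trans (fK x Ex) (ltW Ky).
Qed.

Lemma coord_le_vnorm (a : I -> R) i : `|a i| <= vnorm a.
Proof.
rewrite -(@ler_pXn2r _ 2) ?nnegrE ?vnorm_ge0 // real_normK ?num_real //.
rewrite sqr_vnorm (bigD1 i) //= lerDl.
by apply: sumr_ge0 => j _; exact: sqr_ge0.
Qed.

Let ih i : rho.-integrable E (EFin \o (fun x => h x i)).
Proof.
by apply: (@integrable_on _ M) => // x /hM; apply: le_trans; exact: coord_le_vnorm.
Qed.

Let ihE i : \int[rho]_(x in E) h x i = p * v i.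
Proof.
by rewrite vE -(Rintegral_full_subset (mh i)) mulrA mulfV ?mul1r // gt_eqF.
Qed.

Lemma Rintegral_sum (J : finType) (f : J -> T -> R) :
  (forall j, rho.-integrable E (EFin \o f j)) ->
  \int[rho]_(x in E) (\sum_j f j x) = \sum_j \int[rho]_(x in E) f j x.
Proof.
move=> fi; rewrite /Rintegral; under eq_integral do rewrite -sumEFin.
rewrite (integral_sum mE fi) sum_fine // => j _.
exact: (integrable_fin_num mE (fi j)).
Qed.

(* Jensen's inequality for the norm. *)
Lemma vnorm_mean_le : vnorm v <= M.
Proof.
have iv i : rho.-integrable E (EFin \o (fun x => v i * h x i)).
  exact: (integrableZl mE (v i) (ih i)).
have [v0|v0] := eqVneq (vnorm v) 0; first by rewrite v0 ltW.
have vgt0 : 0 < vnorm v by rewrite lt_def v0 vnorm_ge0.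
(* Pairing with [v] itself: $p|v|^2=\int_E\langle v,h\rangle\,d\rho\le p|v|M$. *)
rewrite -(ler_pM2l vgt0) -(ler_pM2l p0) -expr2 sqr_vnorm.
have -> : p * \sum_i v i ^+ 2 = \int[rho]_(x in E) (\sum_i v i * h x i).
  rewrite Rintegral_sum // mulr_sumr; apply: eq_bigr => i _.
  by rewrite RintegralZl // ihE; ring.
have -> : p * (vnorm v * M) = \int[rho]_(x in E) (vnorm v * M).
  by rewrite Rintegral_cst // fine_rhoE mulrC.
have le x : E x -> `|\sum_i v i * h x i| <= vnorm v * M.
  move=> Ex; apply: le_trans (cauchy_schwarz _ _) _.
  by rewrite ler_wpM2l ?vnorm_ge0 ?hM.
apply: le_Rintegral => //.
- apply: (integrable_on _ le); apply: measurable_sum => i.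
  exact: measurable_funM.
- by apply: (@integrable_on _ `|vnorm v * M|).
- by move=> x /le; apply: le_trans; exact: ler_norm.
Qed.

(** Normalised to have norm at most 1, mean 0 and second moment at most $p$, as [deviation_bound]
    requires; the 2 comes from $|h-v|\le2M$ on [E]. *)
Definition cell_score (x : T) (i : I) : R := \1_E x * ((h x i - v i) / (2 * M)).

Lemma measurable_cell_score i : measurable_fun setT (fun x => cell_score x i).
Proof.
apply: measurable_funM; first exact: measurable_indic.
by apply: measurable_funM => //; exact: measurable_funB.
Qed.

Lemma vnorm_cell_score x : vnorm (cell_score x) <= 1.
Proof.
rewrite /cell_score vnormZ indicE; case: (boolP (x \in E)) => [/set_mem Ex|_]; last first.
  by rewrite normr0 mul0r.
rewrite normr1 mul1r (@eq_vnorm _ _ _ (fun i => (2 * M)^-1 * (h x i + - v i))).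
  rewrite vnormZ ger0_norm ?invr_ge0 ?mulr_ge0 ?(ltW M0) // [leLHS]mulrC ler_pdivrMr ?mulr_gt0 //.
  rewrite mul1r (le_trans (vnormD _ _)) // vnormN.
  by have := hM Ex; have := vnorm_mean_le; lra.
by move=> i; rewrite mulrC.
Qed.

Lemma integral_indicM (f : T -> R) :
  (\int[rho]_x (\1_E x * f x)%:E = \int[rho]_(x in E) (f x)%:E)%E.
Proof.
rewrite [RHS]integral_mkcond; apply: eq_integral => x _.
by rewrite patchE indicE; case: ifP => _ /=; rewrite ?mul1r ?mul0r.
Qed.

Lemma integral_cell_score i : (\int[rho]_x (cell_score x i)%:E = 0)%E.
Proof.
have iE : rho.-integrable E (EFin \o (fun x => (h x i - v i) / (2 * M))).
  apply: (@integrable_on _ 1).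
    by apply: measurable_funM => //; exact: measurable_funB.
  move=> x Ex; apply: le_trans (vnorm_cell_score x).
  apply: le_trans (coord_le_vnorm _ i).
  by rewrite /cell_score indicE mem_set // mul1r.
rewrite /cell_score integral_indicM -[LHS]fineK; last exact: integrable_fin_num.
congr _%:E; rewrite -/(Rintegral rho E (fun x => (h x i - v i) / (2 * M))).
have iB : rho.-integrable E (EFin \o (fun x => h x i - v i)).
  apply: (@integrable_on _ (M + `|v i|)); first exact: measurable_funB.
  move=> x Ex; apply: le_trans (ler_normB _ _) _; rewrite lerD2r.
  exact: le_trans (coord_le_vnorm _ _) (hM Ex).
have ic : rho.-integrable E (EFin \o (fun=> v i)).
  exact: (@integrable_on _ `|v i|).
by rewrite RintegralZr // RintegralB // ihE Rintegral_cst // fine_rhoE (mulrC p) subrr mul0r.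
Qed.

Lemma integral_sqr_cell_score :
  (\int[rho]_x (vnorm (cell_score x) ^+ 2)%:E <= p%:E)%E.
Proof.
have -> : p%:E = (\int[rho]_x (\1_E x)%:E)%E.
  by rewrite integral_indic // setIT -fine_rhoE fineK // fin_num_measure.
apply: ge0_le_integral => //.
- by move=> x _; rewrite lee_fin sqr_ge0.
- apply/measurable_EFinP; apply: measurable_funX; apply: measurable_vnorm.
  exact: measurable_cell_score.
- by apply/measurable_EFinP; exact: measurable_indic.
- move=> x _; rewrite lee_fin indicE; case: (boolP (x \in E)) => [_|xE].
    by rewrite exprn_ile1 ?vnorm_ge0 ?vnorm_cell_score.
  rewrite /cell_score vnormZ indicE (negbTE xE) normr0 mul0r expr0n //.
Qed.

End cell_mean.

Section cell_count.
Context {R : realType} d (T : measurableType d) (rho : probability T R).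
Variables (C : set T) (mC : measurable C).
Let p := fine (rho C).

(** Indexed by [unit], so that the scalar count falls under the vector inequality. *)
Definition count_score (x : T) (i : unit) : R := \1_C x - p.

Let p01 : 0 <= p <= 1.
Proof.
rewrite /p fine_ge0 ?measure_ge0 //= -lee_fin fineK ?fin_num_measure //.
exact: probability_le1.
Qed.

Lemma measurable_count_score i : measurable_fun setT (fun x => count_score x i).
Proof. by apply: measurable_funB => //; exact: measurable_indic. Qed.

Lemma vnorm_unit (a : unit -> R) : vnorm a = `|a tt|.
Proof. by rewrite /vnorm (big_pred1 tt) ?sqrtr_sqr // => -[]. Qed.

Lemma vnorm_count_score x : vnorm (count_score x) <= 1.
Proof.
case/andP: p01 => p_ge0 p_le1.
rewrite vnorm_unit /count_score indicE ler_norml.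
by case: (x \in C) => /=; lra.
Qed.

Let integrable_indic : rho.-integrable setT (EFin \o (\1_C : T -> R)).
Proof.
apply: (@bounded_integrable _ _ _ _ _ 1); first exact: measurable_indic.
by move=> x; rewrite indicE; case: (x \in C); rewrite ?normr1 ?normr0.
Qed.

Let int_indic : (\int[rho]_x (\1_C x)%:E = p%:E)%E.
Proof. by rewrite integral_indic // setIT fineK // fin_num_measure. Qed.

Lemma integral_count_score i : (\int[rho]_x (count_score x i)%:E = 0)%E.
Proof.
rewrite /count_score; under eq_integral do rewrite EFinB.
rewrite integralB //; last exact: (@bounded_integrable _ _ _ _ (fun=> p) `|p|).
by rewrite int_indic integral_cst_prob subee.
Qed.

(** The integral is the variance $p-p^2$ of an indicator. *)
Lemma integral_sqr_count_score :
  (\int[rho]_x (vnorm (count_score x) ^+ 2)%:E <= p%:E)%E.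
Proof.
case/andP: p01 => p_ge0 p_le1.
have -> : (\int[rho]_x (vnorm (count_score x) ^+ 2)%:E =
    \int[rho]_x ((1 - 2 * p)%:E * (\1_C x)%:E + (p ^+ 2)%:E))%E.
  apply: eq_integral => x _; rewrite vnorm_unit real_normK ?num_real //.
  rewrite -EFinM -EFinD /count_score indicE; congr _%:E.
  by case: (x \in C) => /=; ring.
rewrite integralD //; last 2 first.
- exact: (integrableZl measurableT (1 - 2 * p) integrable_indic).
- exact: (@bounded_integrable _ _ _ _ (fun=> p ^+ 2) `|p ^+ 2|).
rewrite (integralZl measurableT integrable_indic) /= int_indic integral_cst_prob.
rewrite -EFinM -EFinD lee_fin; have := sqr_ge0 p; lra.
Qed.

End cell_count.

Section borel.
Context {R : realType} {D : nat}.

Lemma measurable_coord (i : 'I_D) :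
  measurable_fun setT (fun x : borelV R D => (x : 'rV[R]_D) ord0 i).
Proof.
apply: (measurability _ (RGenOInfty.measurableE R)) => _ [_ [a ->] <-].
rewrite setTI; apply: sub_sigma_algebra.
have -> : `]a, +oo[%classic = [set y : R | a < y].
  by apply/seteqP; split => y /=; rewrite in_itv /= andbT.
have : continuous (fun M : 'rV[R]_D => M ord0 i) by exact: coord_continuous.
by move=> /continuousP; apply; exact: open_gt.
Qed.

End borel.

(** * Deterministic perturbation of the affine projection of one cell *)

Lemma outer_sub (R : realType) D (a b : 'rV[R]_D) :
  (a - b)^T *m (a - b) = a^T *m a - a^T *m b - b^T *m a + b^T *m b.
Proof.
by rewrite [(a - b)^T]linearB /= mulmxBl !mulmxBr opprD opprK addrA.
Qed.

Section empirical_cell.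
Context {R : realType} {D n : nat}.
Variables (x : 'I_n -> 'rV[R]_D) (C : set 'rV[R]_D) (c c0 : 'rV[R]_D) (r : R).
Hypothesis xC : forall k, x k \in C -> enorm (x k - c) <= r.
Hypothesis c0r : enorm (c0 - c) <= r.
Let N : R := (emp_count x C)%:R.

Lemma sum_emp_count (V : lmodType R) (v : V) :
  \sum_(k < n | x k \in C) v = N *: v.
Proof. by rewrite sumr_const /N /emp_count cardsE scaler_nat. Qed.

Lemma emp_mean_sub : N != 0 ->
  emp_mean x C c0 - c = N^-1 *: \sum_(k < n | x k \in C) (x k - c).
Proof.
move=> N0; rewrite /emp_mean; case: eqP => [N00|_].
  by move: N0; rewrite /N N00 eqxx.
by rewrite sumrB sum_emp_count scalerBr scalerA mulVf // scale1r.
Qed.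

Lemma enorm_sum_le (J : finType) (P : pred J) (f : J -> 'rV[R]_D) :
  enorm (\sum_(k | P k) f k) <= \sum_(k | P k) enorm (f k).
Proof.
elim/big_rec2: _ => [|k y1 y2 _ IH]; first by rewrite enorm0.
by rewrite (le_trans (enormD _ _)) // lerD2l.
Qed.

(** An average of points of a ball stays in the ball; for an empty cell the value is [c0], which
    lies there by hypothesis. *)
Lemma emp_mean_near : enorm (emp_mean x C c0 - c) <= r.
Proof.
have [N0|N0] := eqVneq N 0.
  rewrite /emp_mean; move/eqP: N0; rewrite /N pnatr_eq0 => /eqP ->.
  by rewrite eqxx.
rewrite emp_mean_sub // enormZ ger0_norm ?invr_ge0 ?ler0n //.
have Ngt0 : 0 < N by rewrite lt_def N0 ler0n.
rewrite mulrC ler_pdivrMr // (le_trans (enorm_sum_le _ _)) //.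
have -> : r * N = \sum_(k < n | x k \in C) r.
  by rewrite sumr_const /N /emp_count cardsE mulr_natr.
by apply: ler_sum => k; exact: xC.
Qed.

(** Centring at the empirical mean instead of [c] costs only the rank-one term $u^Tu$; the remaining
    sum over samples is the one that concentrates. *)
Lemma emp_cov_sub (S : 'M[R]_D) : N != 0 ->
  let u := emp_mean x C c0 - c in
  emp_cov x C c0 - S =
  N^-1 *: \sum_(k < n | x k \in C) ((x k - c)^T *m (x k - c) - S) - u^T *m u.
Proof.
move=> N0 u; rewrite /emp_cov -/N.
have uE : \sum_(k < n | x k \in C) (x k - c) = N *: u.
  by rewrite /u emp_mean_sub // scalerA mulfV // scale1r.
have -> : \sum_(i < n | x i \in C) (x i - emp_mean x C c0)^T *m (x i - emp_mean x C c0)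
   = \sum_(i < n | x i \in C) (x i - c)^T *m (x i - c) - N *: (u^T *m u).
  transitivity (\sum_(i < n | x i \in C) ((x i - c)^T *m (x i - c)
     - (x i - c)^T *m u - u^T *m (x i - c) + u^T *m u)).
    apply: eq_bigr => i _.
    rewrite -outer_sub; suff -> : x i - emp_mean x C c0 = (x i - c) - u by [].
    by rewrite /u opprB addrA subrK.
  rewrite big_split /= !sumrB -mulmx_suml -mulmx_sumr -linear_sum /= uE.
  rewrite linearZ /= -scalemxAl -scalemxAr sum_emp_count subrK //.
rewrite sumrB sum_emp_count !scalerBr !scalerA mulVf // !scale1r.
by rewrite addrAC.
Qed.

Lemma emp_cov_sym : (emp_cov x C c0)^T = emp_cov x C c0.
Proof.
rewrite /emp_cov linearZ /= linear_sum /=; congr (_ *: _).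
by apply: eq_bigr => k _; rewrite trmx_mul trmxK.
Qed.

Variables (d : nat) (S : 'M[R]_D) (V W : 'M[R]_(d, D)).
Hypotheses (d0 : (0 < d)%N) (dD : (d <= D)%N) (ST : S^T = S).
Hypotheses (tV : top_eigenvectors S V) (tW : emp_topspace x C c0 W).

Lemma emp_topspace_free : row_free W.
Proof. by move: tW; rewrite /emp_topspace; case: ifP => // _ []. Qed.

(** Separates the shift of the centre, seen only orthogonally to the empirical subspace, from the
    rotation of the subspace. *)
Lemma affproj_sub (y : 'rV[R]_D) :
  let c' := emp_mean x C c0 in
  affproj c V y - affproj c' W y =
  ((c - c') - (c - c') *m projm W) + ((y - c) *m projm V - (y - c) *m projm W).
Proof.
move=> c'; rewrite /affproj !orthprojE ?emp_topspace_free //; last by case: tV.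
have -> : y - c' = (y - c) + (c - c') by rewrite addrA subrK.
rewrite (mulmxDl (y - c) (c - c')).
move: ((y - c) *m projm V) ((y - c) *m projm W) ((c - c') *m projm W) => a b e.
rewrite !opprD -!addrA; congr (c + _).
by rewrite [LHS]addrCA; congr (_ + _); rewrite [LHS]addrA [RHS]addrC.
Qed.

(** The centre contributes [r], and so does each of the two projections. *)
Lemma cell_error_trivial (y : 'rV[R]_D) : enorm (y - c) <= r ->
  enorm (affproj c V y - affproj (emp_mean x C c0) W y) <= 3 * r.
Proof.
move=> yc; rewrite affproj_sub.
have fV : row_free V by case: tV.
have fW := emp_topspace_free.
apply: le_trans (enormD _ _) _.
have h1 : enorm (c - emp_mean x C c0 - (c - emp_mean x C c0) *m projm W) <= r.
  apply: le_trans (enorm_projC_le (trmx_projm W) (projmK fW) _) _.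
  by rewrite -enormN opprB emp_mean_near.
have h2 : enorm ((y - c) *m projm V - (y - c) *m projm W) <= r + r.
  apply: le_trans (enormD _ _) _; rewrite enormN.
  apply: lerD; apply: le_trans yc; apply: enorm_proj_le; by [exact: trmx_projm|exact: projmK].
by lra.
Qed.

(** [q] stands for the expected count $np$. The centre moves by at most $4r\,t/q$ and the covariance
    by at most $8r^2\,t/q$, which [davis_kahan] with gap [delta] turns into $16(r^2/\delta)\,t/q$
    for the projection. *)
Lemma cell_error_concentrated (t q delta : R) (y : 'rV[R]_D) :
  0 <= r -> 0 < q -> 0 <= t <= q / 2 -> `|N - q| <= t ->
  enorm (\sum_(k < n | x k \in C) (x k - c)) <= 2 * r * t ->
  frob (\sum_(k < n | x k \in C) ((x k - c)^T *m (x k - c) - S))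
    <= 2 * r ^+ 2 * t ->
  0 < delta <= (eigvals S)`_d.-1 - (eigvals S)`_d ->
  enorm (y - c) <= r ->
  enorm (affproj c V y - affproj (emp_mean x C c0) W y) <=
    r * (4 + 16 * (r ^+ 2 / delta)) * (t / q).
Proof.
move=> r0 q0 /andP[t0 tq] Nq hm hS /andP[del0 delle] yc.
have Nge : q / 2 <= N by move: Nq; rewrite ler_norml => /andP[]; lra.
have Ngt0 : 0 < N by apply: lt_le_trans Nge; lra.
have N0 : N != 0 by rewrite gt_eqF.
have Ninv : N^-1 <= 2 / q.
  by rewrite -(invf_div q 2) lef_pV2 ?posrE //; lra.
set u := emp_mean x C c0 - c.
have hu : enorm u <= 4 * r * (t / q).
  rewrite /u emp_mean_sub // enormZ ger0_norm ?invr_ge0 ?(ltW Ngt0) //.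
  have Ni0 : 0 <= N^-1 by rewrite invr_ge0 ltW.
  apply: le_trans (ler_pM Ni0 (enorm_ge0 _) Ninv hm) _.
  by rewrite le_eqVlt; apply/orP; left; apply/eqP; field; rewrite gt_eqF.
have hur : enorm u <= r by exact: emp_mean_near.
have tq0 : 0 <= t / q by rewrite divr_ge0 // ltW.
have hcov : frob (S - emp_cov x C c0) <= 8 * r ^+ 2 * (t / q).
  rewrite -frobN opprB (emp_cov_sub S N0) -/u; apply: le_trans (frobD _ _) _.
  rewrite frobN frob_outer frobZ ger0_norm ?invr_ge0 ?(ltW Ngt0) //.
  have Ni0 : 0 <= N^-1 by rewrite invr_ge0 ltW.
  have h1 := ler_pM Ni0 (frob_ge0 _) Ninv hS.
  (* One factor $|u|$ is bounded by $r$, so that the quadratic term becomes linear in $t/q$. *)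
  have h2 : enorm u * enorm u <= 4 * r * (t / q) * r.
    by apply: ler_pM; rewrite ?enorm_ge0.
  apply: le_trans (lerD h1 h2) _.
  by rewrite le_eqVlt; apply/orP; left; apply/eqP; field; rewrite gt_eqF.
have tW' : top_eigenvectors (emp_cov x C c0) W.
  move: tW; rewrite /emp_topspace; case: ifP => // /eqP N00.
  by move: N0; rewrite /N N00 eqxx.
have gap : (eigvals S)`_d < (eigvals S)`_d.-1 by lra.
have dk := davis_kahan d0 dD ST emp_cov_sym tV tW' gap.
have hP : frob (projm V - projm W) <= 16 * (r ^+ 2 / delta) * (t / q).
  have h1 : delta * frob (projm V - projm W) <= 16 * r ^+ 2 * (t / q).
    apply: le_trans (ler_wpM2r (frob_ge0 _) delle) _.
    by apply: le_trans dk _; move: hcov; lra.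
  rewrite -(ler_pM2l del0); apply: le_trans h1 _.
  by rewrite le_eqVlt; apply/orP; left; apply/eqP; field; rewrite !gt_eqF.
rewrite affproj_sub; apply: le_trans (enormD _ _) _.
have h1 : enorm (c - emp_mean x C c0 - (c - emp_mean x C c0) *m projm W) <=
    4 * r * (t / q).
  apply: le_trans (enorm_projC_le (trmx_projm W) (projmK emp_topspace_free) _) _.
  by rewrite -enormN opprB.
have h2 : enorm ((y - c) *m projm V - (y - c) *m projm W) <=
    r * (16 * (r ^+ 2 / delta) * (t / q)).
  rewrite -mulmxBr; apply: le_trans (enorm_mulmx_le _ _) _.
  by apply: ler_pM; rewrite ?enorm_ge0 ?frob_ge0.
by apply: le_trans (lerD h1 h2) _; rewrite le_eqVlt; apply/orP; left; apply/eqP; ring.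
Qed.

End empirical_cell.

(** * Concentration of the samples in one cell *)

Lemma iid_samples_prod (R : realType) (D n : nat) (dO : measure_display)
    (Omega : measurableType dO) (P : probability Omega R)
    (rho : probability (borelV R D) R) (X : 'I_n -> {RV P >-> borelV R D}) :
  iid_samples rho X ->
  forall B : 'I_n -> set (borelV R D), (forall i, measurable (B i)) ->
  P (\bigcap_(i in [set: 'I_n]) (X i @^-1` B i)) = (\prod_(i < n) rho (B i))%E.
Proof.
move=> [XD XI] B mB; rewrite XI //; apply: eq_bigr => i _.
exact: (XD i (B i) (mB i)).
Qed.

Lemma union_bound d (T : measurableType d) (R : realType) (P : probability T R)
    (I : finType) (A : I -> set T) : (forall i, measurable (A i)) ->
  (P (\bigcup_(i in [set: I]) A i) <= \sum_i P (A i))%E.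
Proof.
move=> mA; have -> : \bigcup_(i in [set: I]) A i =
    \big[setU/set0]_(i <- index_enum I) A i.
  by rewrite -bigcup_seq; congr bigcup; apply/seteqP; split => i //= _;
    rewrite mem_index_enum.
elim: (index_enum I) => [|i s IH]; first by rewrite !big_nil measure0.
rewrite !big_cons; apply: le_trans (measureU2 _ _ _) _ => //.
  by apply: bigsetU_measurable.
exact: leeD2l.
Qed.

Section cell_samples.
Context {R : realType} {D n : nat} {dO : measure_display}.
Context {Omega : measurableType dO} {P : probability Omega R}.
Context {rho : probability (borelV R D) R}.
Variable X : 'I_n -> {RV P >-> borelV R D}.
Hypothesis iidX : iid_samples rho X.
Variables (C : set 'rV[R]_D) (r : R).
Hypotheses (mC : measurable (C : set (borelV R D))) (r0 : 0 < r).
Hypothesis rhoC : (0 < rho C)%E.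
Let c := cond_mean rho C.
Hypothesis ballC : {ae rho, forall x, C x -> enorm ((x : 'rV[R]_D) - c) <= r}.
Let p := fine (rho C).

(** The radius bound (A4) holds almost surely; on this part of the cell it holds everywhere. *)
Definition cell_core : set (borelV R D) :=
  C `&` [set x | enorm ((x : 'rV[R]_D) - c) <= r].

Lemma measurable_enorm_sub (a : 'rV[R]_D) :
  measurable_fun setT (fun x : borelV R D => enorm ((x : 'rV[R]_D) - a)).
Proof.
apply: (measurable_vnorm (f := fun (x : borelV R D) i => ((x : 'rV[R]_D) - a) ord0 i)).
move=> i; under eq_fun do rewrite !mxE.
by apply: measurable_funB => //; exact: measurable_coord.
Qed.

Lemma measurable_cell_core : measurable cell_core.
Proof.
apply: measurableI => //.
rewrite (_ : [set _ | _] =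
  (fun x : borelV R D => enorm ((x : 'rV[R]_D) - c)) @^-1` `]-oo, r]).
  by rewrite -[X in measurable X]setTI; exact: measurable_enorm_sub.
by apply/seteqP; split => x /=; rewrite in_itv.
Qed.

Lemma rho_cell_core : rho (C `\` cell_core) = 0%E.
Proof.
apply/eqP; rewrite -measure_le0.
have [N [mN N0 sN]] := ballC.
rewrite -N0; apply: le_measure; rewrite ?inE //.
  by apply: measurableD => //; exact: measurable_cell_core.
move=> x [Cx nE]; apply: sN => /= h; apply: nE; split => //; exact: h.
Qed.

Let p0 : 0 < p.
Proof.
rewrite /p fine_gt0 // rhoC /=; apply: (le_lt_trans (probability_le1 rho mC)).
exact: ltry.
Qed.

Let mE := measurable_cell_core.
Let EC : cell_core `<=` C. Proof. by move=> x []. Qed.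

Definition coord_dev (x : borelV R D) (i : 'I_D) : R := ((x : 'rV[R]_D) - c) ord0 i.

Definition outer_dev (x : borelV R D) (ij : 'I_D * 'I_D) : R :=
  coord_dev x ij.1 * coord_dev x ij.2.

Lemma measurable_coord_dev i : measurable_fun setT (fun x => coord_dev x i).
Proof.
rewrite /coord_dev; under eq_fun do rewrite !mxE.
by apply: measurable_funB => //; exact: measurable_coord.
Qed.

Lemma measurable_outer_dev ij : measurable_fun setT (fun x => outer_dev x ij).
Proof. by apply: measurable_funM; exact: measurable_coord_dev. Qed.

Lemma vnorm_coord_dev x : cell_core x -> vnorm (coord_dev x) <= r.
Proof. by case. Qed.

Lemma outer_devE x ij :
  outer_dev x ij = (((x : 'rV[R]_D) - c)^T *m ((x : 'rV[R]_D) - c)) ij.1 ij.2.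
Proof. by rewrite [RHS]mxE big_ord1 !mxE /outer_dev /coord_dev !mxE. Qed.

Lemma vnorm_outer_dev x : cell_core x -> vnorm (outer_dev x) <= r ^+ 2.
Proof.
move=> [_ xr]; rewrite (eq_vnorm (outer_devE x)) -/(frob _) frob_outer expr2.
by apply: ler_pM; rewrite ?enorm_ge0.
Qed.

Lemma mean_coord_dev i : 0 = p^-1 * \int[rho]_(x in C) coord_dev x i :> R.
Proof.
rewrite (Rintegral_full_subset mC mE EC rho_cell_core (measurable_coord_dev i)).
have cE : c ord0 i = p^-1 * \int[rho]_(x in cell_core) (x : 'rV[R]_D) ord0 i.
  rewrite {1}/c /cond_mean !mxE -/p; congr (_ * _).
  by rewrite (Rintegral_full_subset mC mE EC rho_cell_core (measurable_coord i)).
rewrite (@eq_Rintegral _ _ _ _ _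
  (fun x : borelV R D => (x : 'rV[R]_D) ord0 i - c ord0 i)); last first.
  by move=> x _; rewrite /coord_dev !mxE.
rewrite RintegralB //.
- rewrite Rintegral_cst // (fine_rhoE mC mE EC rho_cell_core) -/p cE.
  by field; rewrite gt_eqF.
- apply: (@integrable_on _ _ _ _ _ mE _ (r + `|c ord0 i|)); first exact: measurable_coord.
  move=> x [_ xr]; rewrite -[x ord0 i](subrK (c ord0 i)).
  apply: le_trans (ler_normD _ _) _; rewrite lerD2r.
  apply: le_trans xr; have := coord_le_enorm ((x : 'rV[R]_D) - c) i.
  by rewrite !mxE.
- by apply: (@integrable_on _ _ _ _ _ mE _ `|c ord0 i|).
Qed.

Lemma mean_outer_dev ij : cond_cov rho C ij.1 ij.2 =
  p^-1 * \int[rho]_(x in C) outer_dev x ij.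
Proof. by rewrite /cond_cov !mxE. Qed.

(** A null event; off it, samples in [C] obey the radius bound without exception. *)
Definition escape : set Omega :=
  \bigcup_(k in [set: 'I_n]) (X k @^-1` (C `\` cell_core)).

Lemma measurable_escape : measurable escape.
Proof.
apply: fin_bigcup_measurable => // k _.
rewrite -[X in measurable X]setTI; apply: measurable_funP => //.
by apply: measurableD => //; exact: mE.
Qed.

Lemma escape0 : P escape = 0%E.
Proof.
apply/eqP; rewrite -measure_le0.
pose N : set (borelV R D) := C `\` cell_core.
have mN : measurable N by apply: measurableD => //; exact: mE.
have mXN k : measurable (X k @^-1` N).
  by rewrite -[X in measurable X]setTI; exact: measurable_funP.
apply: (le_trans (union_bound P mXN)).
rewrite big1 // => k _; have [XD _] := iidX.
exact: (etrans (XD k N mN) rho_cell_core).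
Qed.

Lemma escape_near w : ~ escape w ->
  forall k, (X k w \in C) = (X k w \in cell_core).
Proof.
move=> nE k; apply/idP/idP => /set_mem h; apply/mem_set; last exact: EC.
by apply: contrapT => nC; apply: nE; exists k.
Qed.

(** Undoes the normalisation in [cell_score]: off [escape], a sample is in [C] exactly when it is in
    the core. *)
Lemma sample_sum_cell (I : finType) (h : borelV R D -> I -> R) (v : I -> R)
    (M : R) w : ~ escape w -> 0 < M ->
  vnorm (fun i => \sum_(k < n | X k w \in C) (h (X k w) i - v i)) =
  2 * M * vnorm (sample_sum X (cell_score cell_core h v M) w).
Proof.
move=> nE M0; rewrite -[2 * M]ger0_norm ?mulr_ge0 ?(ltW M0) // -vnormZ.
apply: eq_vnorm => i; rewrite /sample_sum mulr_sumr big_mkcond /=.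
apply: eq_bigr => k _; rewrite /cell_score indicE -(escape_near nE).
case: (X k w \in C); last by rewrite mul0r mulr0.
by rewrite mul1r mulrC mulfVK // gt_eqF // mulr_gt0.
Qed.

Definition cell_concentrated (t : R) (w : Omega) :=
  [/\ `|(emp_count (fun i => X i w) C)%:R - n%:R * p| <= t,
     enorm (\sum_(k < n | X k w \in C) ((X k w : 'rV[R]_D) - c)) <= 2 * r * t &
     frob (\sum_(k < n | X k w \in C)
       (((X k w : 'rV[R]_D) - c)^T *m ((X k w : 'rV[R]_D) - c) - cond_cov rho C))
     <= 2 * r ^+ 2 * t].

Lemma not_escape_near w : ~ escape w ->
  forall k, X k w \in C -> enorm ((X k w : 'rV[R]_D) - c) <= r.
Proof. by move=> nE k; rewrite (escape_near nE) => /set_mem[]. Qed.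

(** Three uses of [deviation_bound], for the count, the centred points and their outer products,
    give $3\cdot2=6$. *)
Lemma cell_concentration (t : R) : (0 < n)%N -> 0 <= t <= 6 * n%:R * p ->
  exists B : set Omega, [/\ measurable B,
    (P B <= (6 * expR (- (t ^+ 2 / (12 * n%:R * p))))%:E)%E &
    forall w, ~ escape w -> ~ B w -> cell_concentrated t w].
Proof.
move=> n0 tle.
have iid := iid_samples_prod iidX.
have CE0 := rho_cell_core.
pose s0 := count_score rho C.
pose s1 := cell_score cell_core coord_dev (fun=> 0) r.
pose s2 := cell_score cell_core outer_dev
  (fun ij : 'I_D * 'I_D => cond_cov rho C ij.1 ij.2) (r ^+ 2).
have r20 : 0 < r ^+ 2 by rewrite exprn_gt0.
have ms1 i : measurable_fun setT (fun x => s1 x i).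
  exact: (measurable_cell_score mE _ _ measurable_coord_dev).
have ms2 i : measurable_fun setT (fun x => s2 x i).
  exact: (measurable_cell_score mE _ _ measurable_outer_dev).
have d0 := deviation_bound iid (measurable_count_score rho mC)
  (vnorm_count_score rho mC) (integral_count_score rho mC)
  (integral_sqr_count_score rho mC) p0 n0 tle.
have d1 := deviation_bound iid ms1
  (vnorm_cell_score mC mE EC CE0 p0 measurable_coord_dev vnorm_coord_dev r0 mean_coord_dev)
  (integral_cell_score mC mE EC CE0 p0 measurable_coord_dev vnorm_coord_dev r0 mean_coord_dev)
  (integral_sqr_cell_score mC mE EC CE0 p0 measurable_coord_dev vnorm_coord_dev r0 mean_coord_dev)
  p0 n0 tle.
have d2 := deviation_bound iid ms2
  (vnorm_cell_score mC mE EC CE0 p0 measurable_outer_dev vnorm_outer_dev r20 mean_outer_dev)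
  (integral_cell_score mC mE EC CE0 p0 measurable_outer_dev vnorm_outer_dev r20 mean_outer_dev)
  (integral_sqr_cell_score mC mE EC CE0 p0 measurable_outer_dev vnorm_outer_dev r20 mean_outer_dev)
  p0 n0 tle.
set A0 := [set _ | _] in d0; set A1 := [set _ | _] in d1; set A2 := [set _ | _] in d2.
have mA0 : measurable A0 by apply: measurable_deviation; exact: measurable_count_score.
have mA1 : measurable A1 by exact: measurable_deviation.
have mA2 : measurable A2 by exact: measurable_deviation.
exists (A0 `|` A1 `|` A2); split.
- by apply: measurableU => //; exact: measurableU.
- apply: le_trans (measureU2 _ _ _) _ => //; first exact: measurableU.
  set e := expR _ in d0 d1 d2 *.
  have -> : (6 * e = 2 * e + 2 * e + 2 * e)%R by ring.
  rewrite !EFinD; apply: leeD => //.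
  apply: le_trans (measureU2 _ _ _) _ => //; exact: leeD.
move=> w nE /not_orP[/not_orP[/negP]]; rewrite -!ltNge => n0w.
move=> /negP; rewrite -ltNge => n1w /negP; rewrite -ltNge => n2w.
split.
- apply: le_trans (ltW n0w); rewrite vnorm_unit /sample_sum /s0 /count_score.
  rewrite sumrB sumr_const card_ord -(mulr_natl (fine (rho C)) n).
  rewrite le_eqVlt; apply/orP; left; apply/eqP; congr (`|_ - _|).
  rewrite /emp_count -sum1_card natr_sum big_mkcond /=.
  by apply: eq_bigr => k _; rewrite inE indicE; case: (X k w \in C).
- have := sample_sum_cell coord_dev (fun=> 0) nE r0.
  rewrite -/s1 => E1; rewrite enormE (@eq_vnorm _ _ _
    (fun i => \sum_(k < n | X k w \in C) (coord_dev (X k w) i - 0))); last first.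
    by move=> i; rewrite summxE; apply: eq_bigr => k _; rewrite subr0.
  by rewrite E1 ler_wpM2l ?mulr_ge0 ?(ltW r0) // ltW.
- have := sample_sum_cell outer_dev
    (fun ij : 'I_D * 'I_D => cond_cov rho C ij.1 ij.2) nE r20.
  rewrite -/s2 => E2; rewrite /frob (@eq_vnorm _ _ _
    (fun ij => \sum_(k < n | X k w \in C)
      (outer_dev (X k w) ij - cond_cov rho C ij.1 ij.2))); last first.
    by move=> ij; rewrite summxE; apply: eq_bigr => k _; rewrite outer_devE [LHS]mxE [X in _ + X]mxE.
  by rewrite E2 ler_wpM2l ?mulr_ge0 ?(ltW r20) // ltW.
Qed.

End cell_samples.

(** * Disjointness of cells, the $L^2$ error and integration over cells *)

(* Two overlapping cells would share a cell of the next scale, which has a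
   unique parent. *)
Lemma same_scale_disjoint (R : realType) (D amin amax : nat)
    (rho : probability (borelV R D) R) (M : set 'rV[R]_D) (T : cell_family R D)
    (j : int) (k k' : 'I_(ncells T j)) :
  measurable (M : set (borelV R D)) ->
  cells_wf rho M T -> axA1 amin amax rho T -> axA2 rho M T ->
  jmin T <= j -> k != k' -> rho (cell k `&` cell k') = 0%E.
Proof.
move=> mM [_ wf] A1 A2 jj kk'.
have jj1 : jmin T <= j + 1 by rewrite (le_trans jj) // lerDl.
have mcell (i : int) (l : 'I_(ncells T i)) : jmin T <= i ->
    measurable (cell l : set (borelV R D)).
  by move=> ii; have [] := wf i l ii.
pose N : set (borelV R D) :=
  M `\` \bigcup_(m in [set: 'I_(ncells T (j + 1))]) cell m.
pose I2 : set (borelV R D) := cell k `&` cell k'.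
have mI2 : measurable I2 by apply: measurableI; exact: mcell.
have mN : measurable N.
  by apply: measurableD => //; apply: fin_bigcup_measurable => // m _; exact: mcell.
pose A (m : 'I_(ncells T (j + 1))) : set (borelV R D) := cell m `&` I2.
have mA m : measurable (A m) by apply: measurableI => //; exact: mcell.
have A0 m : rho (A m) = 0%E.
  have [a1 _ a3] := A1 j jj.
  have null (l : 'I_(ncells T j)) : I2 `<=` cell l ->
      rho (cell m `&` cell l) = 0%E -> rho (A m) = 0%E.
    move=> sl l0; apply/eqP; rewrite -measure_le0 -l0.
    apply: le_measure; rewrite ?inE //; first by apply: measurableI; exact: mcell.
    by move=> x [xm /sl xl].
  (* A cell of the next scale inside both [cell k] and [cell k'] would have two parents; otherwise
     it meets one of them in a null set. *)
  have [sk|] := a1 k m; last by apply: null => x [].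
  have [sk'|] := a1 k' m; last by apply: null => x [].
  have [l [_ lu]] := a3 m.
  by move: kk'; rewrite -(lu _ sk) -(lu _ sk') eqxx.
apply/eqP; rewrite -measure_le0.
apply: (@le_trans _ _ (rho (N `|` \bigcup_(m in setT) A m))).
  apply: le_measure; rewrite ?inE //.
    by apply: measurableU => //; apply: fin_bigcup_measurable.
  move=> x xI; have [xU|xU] := pselect ((\bigcup_(m in [set: 'I_(ncells T (j + 1))]) cell m) x).
    by right; case: xU => m _ xm; exists m.
  by left; split => //; have [_ sM _] := wf j k jj; case: xI => /sM.
apply: (le_trans (measureU2 _ _ _)) => //; first exact: fin_bigcup_measurable.
have N0 : rho N = 0%E by exact: (A2 _ jj1).
rewrite [X in (X + _)%E]N0 add0e; apply: (le_trans (union_bound rho mA)).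
by rewrite big1.
Qed.

Section piecewise.
Context {R : realType} {D d : nat} {T : cell_family R D} {j : int}.
Hypothesis mcell : forall k : 'I_(ncells T j), measurable (cell k : set (borelV R D)).
Variables (c : 'I_(ncells T j) -> 'rV[R]_D) (V : 'I_(ncells T j) -> 'M[R]_(d, D)).

Lemma measurable_affproj (a : 'rV[R]_D) (W : 'M[R]_(d, D)) i :
  measurable_fun setT (fun x : borelV R D => (affproj a W (x : 'rV[R]_D)) ord0 i).
Proof.
rewrite /affproj /orthproj; under eq_fun do rewrite !mxE.
apply: measurable_funD => //; apply: measurable_sum => l.
apply: measurable_funM => //; under eq_fun do rewrite !mxE.
by apply: measurable_funB => //; exact: measurable_coord.
Qed.

Lemma measurable_piecewise_affproj i : measurable_fun setT
  (fun x : borelV R D => (piecewise_affproj c V (x : 'rV[R]_D)) ord0 i).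
Proof.
rewrite /piecewise_affproj; under eq_fun do rewrite summxE.
apply: measurable_sum => k; under eq_fun do rewrite mxE.
apply: measurable_funM; last exact: measurable_affproj.
exact: (@measurable_indic _ _ _ setT (cell k : set (borelV R D))).
Qed.

End piecewise.

Lemma measurable_sqr_enorm (R : realType) (D : nat) (f : borelV R D -> 'rV[R]_D) :
  (forall i, measurable_fun setT (fun x => (f x) ord0 i)) ->
  measurable_fun setT (fun x => (enorm (f x) ^+ 2)%:E).
Proof.
move=> mf; apply/measurable_EFinP; apply: measurable_funX.
exact: (measurable_vnorm (f := fun x i => (f x) ord0 i)).
Qed.

Section L2.
Context {R : realType} {D : nat} (rho : probability (borelV R D) R).
Variables (M : set 'rV[R]_D) (mM : measurable (M : set (borelV R D))).

Lemma L2err_le (Q : 'rV[R]_D -> 'rV[R]_D) (a : R) : 0 <= a ->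
  (L2err rho M Q <= a%:E)%E <->
  (\int[rho]_(x in M) (enorm ((x : 'rV[R]_D) - Q x) ^+ 2)%:E <= (a ^+ 2)%:E)%E.
Proof.
move=> a0; rewrite /L2err poweR12_sqrt; last first.
  by apply: integral_ge0 => x _; rewrite lee_fin sqr_ge0.
have -> : a%:E = sqrte (a ^+ 2)%:E by rewrite /= sqrtr_sqr ger0_norm.
by rewrite lee_sqrt // lee_fin sqr_ge0.
Qed.

(* Minkowski's inequality, from (u+v)^2 <= (1+b/a) u^2 + (1+a/b) v^2. *)
Lemma L2err_triangle (Q Q' : 'rV[R]_D -> 'rV[R]_D) (a b : R) :
  (forall i, measurable_fun setT (fun x : borelV R D => (Q x) ord0 i)) ->
  (forall i, measurable_fun setT (fun x : borelV R D => (Q' x) ord0 i)) ->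
  0 < a -> 0 < b -> (L2err rho M Q <= a%:E)%E ->
  (\int[rho]_(x in M) (enorm (Q x - Q' x) ^+ 2)%:E <= (b ^+ 2)%:E)%E ->
  (L2err rho M Q' <= (a + b)%:E)%E.
Proof.
move=> mQ mQ' a0 b0 /(L2err_le _ (ltW a0)) ha hb.
apply/(L2err_le _ (addr_ge0 (ltW a0) (ltW b0))).
have mx (f : borelV R D -> 'rV[R]_D) :
    (forall i, measurable_fun setT (fun x => (f x) ord0 i)) ->
    forall i, measurable_fun setT (fun x : borelV R D => ((x : 'rV[R]_D) - f x) ord0 i).
  move=> mf i; under eq_fun do rewrite !mxE.
  by apply: measurable_funB => //; exact: measurable_coord.
have m1 : measurable_fun (M : set (borelV R D)) (fun x : borelV R D => (enorm ((x : 'rV[R]_D) - Q x) ^+ 2)%:E).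
  by apply: measurable_funTS; exact: (measurable_sqr_enorm (mx _ mQ)).
have m1' : measurable_fun (M : set (borelV R D)) (fun x : borelV R D => (enorm ((x : 'rV[R]_D) - Q' x) ^+ 2)%:E).
  by apply: measurable_funTS; exact: (measurable_sqr_enorm (mx _ mQ')).
have m2 : measurable_fun (M : set (borelV R D)) (fun x : borelV R D => (enorm (Q x - Q' x) ^+ 2)%:E).
  apply: measurable_funTS.
  apply: (measurable_sqr_enorm (f := fun x => Q x - Q' x)) => i.
  by under eq_fun do rewrite !mxE; exact: measurable_funB.
have ab0 : 0 <= 1 + b / a by rewrite addr_ge0 // divr_ge0 // ltW.
have ba0 : 0 <= 1 + a / b by rewrite addr_ge0 // divr_ge0 // ltW.
apply: (@le_trans _ _ (\int[rho]_(x in M)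
   ((1 + b / a)%:E * (enorm ((x : 'rV[R]_D) - Q x) ^+ 2)%:E +
    (1 + a / b)%:E * (enorm (Q x - Q' x) ^+ 2)%:E))%E).
  apply: ge0_le_integral => //.
  - by move=> x _; rewrite lee_fin sqr_ge0.
  - by apply: emeasurable_funD; exact: measurable_funeM.
  - move=> x _; rewrite -!EFinM -EFinD lee_fin.
    set u := enorm (_ - Q x); set v := enorm (Q x - Q' x).
    have tri : enorm ((x : 'rV[R]_D) - Q' x) <= u + v.
      apply: le_trans (enormD _ _).
      by rewrite addrA subrK.
    apply: (@le_trans _ _ ((u + v) ^+ 2)).
      by rewrite ler_pXn2r // ?nnegrE ?addr_ge0 ?enorm_ge0.
    rewrite -subr_ge0.
    have -> : (1 + b / a) * u ^+ 2 + (1 + a / b) * v ^+ 2 - (u + v) ^+ 2 =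
        (b * u - a * v) ^+ 2 / (a * b) by field; rewrite !gt_eqF.
    by rewrite divr_ge0 ?sqr_ge0 // ltW // mulr_gt0.
rewrite ge0_integralD //; first last.
- exact: measurable_funeM.
- by move=> x _; rewrite mule_ge0 // lee_fin sqr_ge0.
- exact: measurable_funeM.
- by move=> x _; rewrite mule_ge0 // lee_fin sqr_ge0.
rewrite !ge0_integralZl //; try by move=> x _; rewrite lee_fin sqr_ge0.
apply: (@le_trans _ _ ((1 + b / a)%:E * (a ^+ 2)%:E + (1 + a / b)%:E * (b ^+ 2)%:E)%E).
  by apply: leeD; apply: lee_wpmul2l.
(* The weights $b/a$ and $a/b$ make the bound equal to $(a+b)^2$. *)
rewrite -!EFinM -EFinD lee_fin le_eqVlt; apply/orP; left; apply/eqP.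
by field; rewrite !gt_eqF.
Qed.

End L2.

(* Since the cells are almost surely disjoint, the squared norm of a sum over
   cells is almost surely the sum of the squared norms. *)
Lemma integral_cells_le (R : realType) (D : nat)
    (rho : probability (borelV R D) R) (M : set 'rV[R]_D) (N : nat)
    (C E : 'I_N -> set (borelV R D)) (f : 'I_N -> borelV R D -> 'rV[R]_D)
    (B : 'I_N -> R) :
  measurable (M : set (borelV R D)) ->
  (forall k, measurable (C k)) -> (forall k, measurable (E k)) ->
  (forall k, rho (C k `\` E k) = 0%E) ->
  (forall k l, k != l -> rho (C k `&` C l) = 0%E) ->
  (forall i, measurable_fun setT
     (fun x => (\sum_k \1_(C k) x *: f k x : 'rV[R]_D) ord0 i)) ->
  (forall k x, E k x -> enorm (f k x) <= B k) ->
  (\int[rho]_(x in M) (enorm (\sum_k \1_(C k) x *: f k x) ^+ 2)%:E <=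
   (\sum_k B k ^+ 2 * fine (rho (C k)))%:E)%E.
Proof.
move=> mM mC mE CE0 C0 mf fB.
(* Exceptional null sets: points of some cell where its bound may fail ([Z1]), and points lying in
   two cells ([Z2]). *)
pose Z1 : set (borelV R D) := \bigcup_(k in [set: 'I_N]) (C k `\` E k).
pose Z2 : set (borelV R D) := \bigcup_(kl in [set: 'I_N * 'I_N])
   (if kl.1 == kl.2 then set0 else C kl.1 `&` C kl.2).
have mCE k : measurable (C k `\` E k) by exact: measurableD.
have mCC (kl : 'I_N * 'I_N) :
    measurable (if kl.1 == kl.2 then set0 else C kl.1 `&` C kl.2).
  by case: ifP => _ //; exact: measurableI.
have mZ1 : measurable Z1 by exact: fin_bigcup_measurable.
have mZ2 : measurable Z2 by exact: fin_bigcup_measurable.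
have Z10 : rho Z1 = 0%E.
  apply/eqP; rewrite -measure_le0 (le_trans (union_bound rho mCE)) //.
  by rewrite big1.
have Z20 : rho Z2 = 0%E.
  apply/eqP; rewrite -measure_le0 (le_trans (union_bound rho mCC)) //.
  rewrite big1 // => -[k l] _ /=; case: eqP => [_|/eqP kl]; first exact: measure0.
  exact: C0.
have B20 (k : 'I_N) (x : borelV R D) : 0 <= B k ^+ 2 * \1_(C k) x :> R.
  by rewrite mulr_ge0 ?sqr_ge0.
have mB : measurable_fun (M : set (borelV R D)) (fun x : borelV R D => (\sum_k B k ^+ 2 * \1_(C k) x)%:E).
  apply/measurable_EFinP; apply: measurable_funTS.
  by apply: measurable_sum => k; apply: measurable_funM => //; exact: measurable_indic.
apply: (@le_trans _ _ (\int[rho]_(x in M) (\sum_k B k ^+ 2 * \1_(C k) x)%:E)%E).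
  apply: ae_ge0_le_integral => //.
  - by move=> x _; rewrite lee_fin sqr_ge0.
  - apply: measurable_funTS.
    exact: (measurable_sqr_enorm mf).
  - by move=> x _; rewrite lee_fin sumr_ge0.
  exists (Z1 `|` Z2); split; first exact: measurableU.
    apply/eqP; rewrite -measure_le0 (le_trans (measureU2 _ _ _)) //.
    by rewrite [X in (X + _)%E]Z10 [X in (_ + X)%E]Z20 adde0.
  move=> x /= nle; apply: contrapT => /not_orP[nZ1 nZ2]; apply: nle => _.
  rewrite lee_fin.
  have [[k Ck]|nC] := pselect (exists k, C k x); last first.
    rewrite big1 => [|k _]; last first.
      rewrite indicE memNset ?scale0r // => Ckx; apply: nC; by exists k.
    by rewrite enorm0 expr0n sumr_ge0.
  have Cl l : l != k -> \1_(C l) x = 0 :> R.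
    move=> lk; rewrite indicE memNset // => Clx; apply: nZ2.
    by exists (l, k) => //=; rewrite (negbTE lk).
  rewrite (bigD1 k) //= big1 => [|l lk]; last by rewrite Cl // scale0r.
  rewrite (bigD1 k) //= big1 => [|l lk]; last by rewrite Cl // mulr0.
  rewrite !addr0 indicE mem_set // scale1r mulr1 ler_pXn2r ?nnegrE ?enorm_ge0 //.
    apply: fB; apply: contrapT => nE; apply: nZ1; by exists k.
  apply: le_trans (enorm_ge0 _) (fB k x _); apply: contrapT => nE.
  by apply: nZ1; exists k.
apply: (@le_trans _ _ (\int[rho]_x (\sum_k B k ^+ 2 * \1_(C k) x)%:E)%E).
  apply: ge0_subset_integral => //.
    apply/measurable_EFinP; apply: measurable_sum => k.
    by apply: measurable_funM => //; exact: measurable_indic.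
  by move=> x _; rewrite lee_fin sumr_ge0.
under eq_integral do rewrite -sumEFin.
rewrite ge0_integral_sum //; last first.
- by move=> k x _; rewrite lee_fin.
- by move=> k; apply/measurable_EFinP; apply: measurable_funM => //.
rewrite -sumEFin; apply: lee_sum => k _.
under eq_integral do rewrite EFinM.
rewrite ge0_integralZl //.
- rewrite integral_indic // setIT [leRHS](EFinM (B k ^+ 2)) lee_wpmul2l ?lee_fin ?sqr_ge0 //.
  by rewrite fineK // fin_num_measure.
- by apply/measurable_EFinP; exact: measurable_indic.
- by rewrite lee_fin sqr_ge0.
Qed.

(** * Arithmetic of the scale and of the rate *)

Section rates.
Context {R : realType}.
Variables (d n : nat) (s : R).
Hypotheses (d0 : (0 < d)%N) (n2 : (2 <= n)%N) (s1 : 1 <= s).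
Let q : R := ln n%:R / n%:R.

Lemma ln_nat_gt0 : 0 < ln n%:R :> R.
Proof. by rewrite ln_gt0 // ltr1n. Qed.

Lemma ln_ratio_gt0 : 0 < q.
Proof. by rewrite divr_gt0 ?ln_nat_gt0 // ltr0n; lia. Qed.

Lemma ln_ratio_le1 : q <= 1.
Proof.
have n0 : 0 < n%:R :> R by rewrite ltr0n; lia.
by rewrite ler_pdivrMr // mul1r ltW // ln_sublinear.
Qed.

Let q01 : 0 < q <= 1. Proof. by rewrite ln_ratio_gt0 ln_ratio_le1. Qed.

Let exponent_ge (d1 : d != 1%N) : d%:R <= 2 * s + d%:R - 2.
Proof. by move: (d%:R : R) => x; move: s1; lra. Qed.

Let exponent_gt0 (d1 : d != 1%N) : 0 < 2 * s + d%:R - 2.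
Proof. by apply: lt_le_trans (exponent_ge d1); rewrite ltr0n. Qed.

Lemma scale_rate_gt0 : 0 < scale_rate d n s.
Proof.
by rewrite /scale_rate; case: eqP => _; rewrite ?powR_gt0 //; exact: ln_ratio_gt0.
Qed.

Lemma error_rate_gt0 : 0 < error_rate d n s.
Proof.
by rewrite /error_rate; case: eqP => _; rewrite ?powR_gt0 //; exact: ln_ratio_gt0.
Qed.

(** The exponent $d/(2s+d-2)$ is at most 1 because $s\ge1$. This keeps the number of cells below a
    multiple of $n/\log n$. *)
Lemma ln_ratio_le_scale : q <= scale_rate d n s ^+ d.
Proof.
rewrite /scale_rate -/q; case: eqP => [->|/eqP d1]; first by rewrite expr1.
rewrite -powR_mulrn ?powR_ge0 // -powRrM -[leLHS]powRr1 ?(ltW ln_ratio_gt0) //.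
apply: ger_powR => //; rewrite mulrC ler_pdivrMr ?exponent_gt0 // mul1r.
exact: exponent_ge.
Qed.

(** An equality of exponents for $d\ge2$; for $d=1$ it is $q^s\le q$ with $q\le1$. *)
Lemma scale_powR_le_error : scale_rate d n s `^ s <= error_rate d n s.
Proof.
rewrite /scale_rate /error_rate -/q; case: eqP => [_|/eqP d1].
  exact: ge1r_powR.
by rewrite -powRrM mulrC.
Qed.

(** The variance balance: up to constants there are [scale_rate]$^{-d}$ cells, each contributing
    $\log n/n$ times the squared scale, and together they make the squared rate. *)
Lemma scale_error_identity :
  q * scale_rate d n s ^+ 2 = error_rate d n s ^+ 2 * scale_rate d n s ^+ d.
Proof.
rewrite /scale_rate /error_rate -/q; case: eqP => [->|/eqP d1].
  by rewrite expr1; ring.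
rewrite -!powR_mulrn ?powR_ge0 // -!powRrM -{1}[q]powRr1 ?(ltW ln_ratio_gt0) //.
have qn0 : q != 0 by rewrite gt_eqF // ln_ratio_gt0.
rewrite -!powRD ?qn0 ?implybT //; congr (_ `^ _).
by field; rewrite gt_eqF // exponent_gt0.
Qed.

End rates.

Lemma gaussian_tail_nat (R : realType) (n : nat) (nu : R) : (0 < n)%N ->
  expR (- ((nu + 1) * ln n%:R)) = n%:R `^ (- nu) / n%:R.
Proof.
move=> n0; have n0' : 0 < n%:R :> R by rewrite ltr0n.
rewrite /powR gt_eqF // -[in X in _ / X](lnK n0') -expRN -expRD.
by congr expR; ring.
Qed.

(** * The error on one cell *)

Lemma cond_cov_sym (R : realType) (D : nat) (rho : probability (borelV R D) R)
    (C : set 'rV[R]_D) : (cond_cov rho C)^T = cond_cov rho C.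
Proof.
apply/matrixP => i j; rewrite !mxE; congr (_ * Rintegral _ _ _).
by apply/funext => x; rewrite mulrC.
Qed.

Lemma cond_topspaceP (R : realType) (d D : nat)
    (rho : probability (borelV R D) R) (C : set 'rV[R]_D) : (d <= D)%N ->
  top_eigenvectors (cond_cov rho C) (cond_topspace d rho C).
Proof.
move=> dD; rewrite /cond_topspace; set Q := [set _ | _].
suff : Q (xget 0 Q) by [].
by apply: xgetPex; apply: top_eigenvectors_exist => //; exact: cond_cov_sym.
Qed.

Section cell_error.
Context {R : realType} {D d n : nat} {dO : measure_display}.
Context {Omega : measurableType dO} {P : probability Omega R}.
Context {rho : probability (borelV R D) R}.
Variable X : 'I_n -> {RV P >-> borelV R D}.
Hypothesis iidX : iid_samples rho X.
Variables (C : set 'rV[R]_D) (r delta K : R).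
Hypotheses (mC : measurable (C : set (borelV R D))) (r0 : 0 < r) (K0 : 0 < K).
Hypothesis rhoC : (0 < rho C)%E.
Let c := cond_mean rho C.
Hypothesis ballC : {ae rho, forall x, C x -> enorm ((x : 'rV[R]_D) - c) <= r}.
Hypotheses (d0 : (0 < d)%N) (dD : (d <= D)%N) (n2 : (2 <= n)%N).
Hypothesis gap : 0 < delta <= (eigvals (cond_cov rho C))`_d.-1 -
                               (eigvals (cond_cov rho C))`_d.
Let p := fine (rho C).

(* On a cell of mass below 4 K ln n / n the crude bound 3 r suffices;
   otherwise the samples concentrate with t = sqrt (K n p ln n). *)
Lemma cell_error : exists B : set Omega, [/\ measurable B,
  (P B <= (6 * expR (- (K / 12 * ln n%:R)))%:E)%E &
  forall w, ~ B w -> forall c0 (W : 'M[R]_(d, D)), enorm (c0 - c) <= r ->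
  emp_topspace (fun i => X i w) C c0 W ->
  exists b : R, [/\ 0 <= b,
    (forall x, cell_core (rho := rho) C r x ->
      enorm (affproj c (cond_topspace d rho C) x -
             affproj (emp_mean (fun i => X i w) C c0) W x) <= b) &
    b ^+ 2 * p <= ((4 + 16 * (r ^+ 2 / delta)) ^+ 2 + 36) * K * r ^+ 2 *
      (ln n%:R / n%:R)]].
Proof.
have n0 : (0 < n)%N by lia.
have nR : 0 < n%:R :> R by rewrite ltr0n.
have L0 : 0 < ln n%:R :> R by exact: ln_nat_gt0.
have S := cond_cov_sym rho C.
have tV := cond_topspaceP rho C dD.
set L : R := ln n%:R in L0 *.
have p0 : 0 < p.
  rewrite /p fine_gt0 // rhoC /=; apply: (le_lt_trans (probability_le1 rho mC)).
  exact: ltry.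
pose esc := escape (rho := rho) X C r.
have mesc : measurable esc by exact: measurable_escape.
have Pesc : P esc = 0%E by exact: (escape0 iidX mC ballC).
set G := 4 + 16 * (r ^+ 2 / delta).
have Lq0 : 0 < L / n%:R by rewrite divr_gt0.
have [del0 _] := andP gap.
have G0 : 0 <= G by rewrite addr_ge0 // mulr_ge0 // divr_ge0 ?sqr_ge0 // ltW.
have [big|small] := leP (4 * K * L) (n%:R * p); last first.
  (* Small mass: only the null event is excluded, and $9r^2\cdot4K\log n/n$ accounts for the term
     36. *)
  exists esc; split => //.
    by rewrite Pesc lee_fin mulr_ge0 // expR_ge0.
  move=> w nE c0 W hc0 hW; exists (3 * r); split.
  - by rewrite mulr_ge0 // ltW.
  - by move=> x [_ xr]; exact: (cell_error_trivial (not_escape_near nE) hc0 tV hW xr).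
  - have hp : p <= 4 * K * (L / n%:R).
      by rewrite mulrA ler_pdivlMr // mulrC ltW.
    apply: (@le_trans _ _ (9 * r ^+ 2 * (4 * K * (L / n%:R)))).
      rewrite exprMn; apply: ler_pM => //; first by rewrite mulr_ge0 ?sqr_ge0.
        exact: ltW.
      by rewrite ler_wpM2r ?sqr_ge0 //; lra.
    have : 0 <= G ^+ 2 * (K * r ^+ 2 * (L / n%:R)).
      by rewrite !mulr_ge0 ?sqr_ge0 // ltW.
    by lra.
(* Chosen so that $t^2/(12np)=\frac K{12}\log n$. *)
pose t := Num.sqrt (K * (n%:R * p) * L).
set m := n%:R * p in t big.
have m0 : 0 < m by rewrite mulr_gt0.
have t0 : 0 <= t by exact: sqrtr_ge0.
have t2 : t ^+ 2 = K * m * L by rewrite sqr_sqrtr // !mulr_ge0 // ltW.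
(* This inequality dictates the threshold $4K\log n$. *)
have tm : t <= m / 2.
  rewrite -(@ler_pXn2r _ 2) ?nnegrE ?divr_ge0 ?(ltW m0) // t2 expr_div_n.
  have -> : K * m * L = m * (K * L) by ring.
  have -> : m ^+ 2 / 2 ^+ 2 = m * (m / 4) by field.
  by rewrite ler_pM2l //; lra.
have tle : 0 <= t <= 6 * n%:R * p by rewrite t0 /= -mulrA -/m; lra.
have [B [mB PB good]] := cell_concentration iidX mC r0 rhoC ballC n0 tle.
exists (esc `|` B); split; first exact: measurableU.
  apply: le_trans (measureU2 _ _ _) _ => //; rewrite [X in (X + _)%E]Pesc add0e.
  suff <- : t ^+ 2 / (12 * n%:R * p) = K / 12 * L by [].
  by rewrite t2 /m; field; rewrite !gt_eqF.
move=> w /not_orP[nE nB] c0 W hc0 hW.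
have [g1 g2 g3] := good w nE nB.
exists (r * G * (t / m)); split.
- by apply: mulr_ge0; [apply: mulr_ge0 => //; exact: ltW|apply: divr_ge0 => //; exact: ltW].
- move=> x [_ xr].
  have t0m : 0 <= t <= m / 2 by rewrite t0.
  exact: (cell_error_concentrated (not_escape_near nE) hc0 d0 dD S tV hW
    (ltW r0) m0 t0m g1 g2 g3 gap xr).
- have -> : (r * G * (t / m)) ^+ 2 * p = G ^+ 2 * K * r ^+ 2 * (L / n%:R).
    rewrite !exprMn exprVn t2 /m; field; rewrite !gt_eqF //.
  have : 0 <= 36 * (K * r ^+ 2 * (L / n%:R)).
    by rewrite !mulr_ge0 ?sqr_ge0 // ltW.
  by lra.
Qed.

End cell_error.

(** * The bias bound and the final assembly *)

(** The supremum over trees dominates the infimum for [T]; the slack [e] avoids asking whether that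
    infimum is attained. *)
Lemma As_norm_L2err (R : realType) (D d : nat)
    (theta1 theta2 theta3 theta4 : R) (amin amax : nat) (s : R)
    (rho : probability (borelV R D) R) (M : set 'rV[R]_D) (T : cell_family R D) :
  let A := As_norm d theta1 theta2 theta3 theta4 amin amax s rho M in
  multiscale_tree d theta1 theta2 theta3 theta4 amin amax rho M T ->
  (A < +oo)%E ->
  0 <= fine A /\
  forall (e : R) (j : int), 0 < e -> jmin T <= j ->
    (L2err rho M (gmra_proj d rho T j) <=
      ((fine A + e) * 2 `^ (- (j%:~R * s)))%:E)%E.
Proof.
move=> A hT Aoo.
set SA := [set A0 : R | forall j : int, jmin T <= j ->
        (L2err rho M (gmra_proj d rho T j) <=
          (A0 * 2 `^ (- (j%:~R * s)))%:E)%E].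
pose I := ereal_inf [set A0%:E | A0 in SA].
have IA : (I <= A)%E by apply: ereal_sup_ubound; exists T.
have SA0 A0 : SA A0 -> 0 <= A0.
  move=> /(_ _ (lexx _)) h.
  have : (0 <= (A0 * 2 `^ (- ((jmin T)%:~R * s)))%:E)%E.
    by apply: le_trans h; rewrite /L2err poweR_ge0.
  by rewrite lee_fin pmulr_lge0 // powR_gt0.
have I0 : (0 <= I)%E.
  by apply: le_ereal_inf_tmp => _ [A0 /SA0 A00 <-]; rewrite lee_fin.
have A0 : (0 <= A)%E by exact: le_trans IA.
have Afin : A \is a fin_num by rewrite ge0_fin_numE.
split; first exact: fine_ge0.
move=> e j e0 jj.
have : (I < (fine A + e)%:E)%E.
  by apply: (le_lt_trans IA); rewrite -{1}(fineK Afin) lte_fin ltrDl.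
move=> /ereal_inf_lt[_ [a aS <-]]; rewrite lte_fin => ae.
apply: le_trans (aS j jj) _; rewrite lee_fin ler_wpM2r ?powR_ge0 //.
exact: ltW.
Qed.

(* The probability is the outer probability (P^* )%mu, which agrees with P on
   measurable events: an arbitrary tie-breaking Vhat need not be measurable. *)
Theorem theorem4 (R : realType) (d : nat)
    (theta1 theta2 theta3 theta4 mu : R)
    (hd : (1 <= d)%N)
    (h1 : 0 < theta1) (h2 : 0 < theta2) (h3 : 0 < theta3)
    (h4 : 0 < theta4 < 1) (hmu : 0 < mu) :
  exists C2 : R, forall nu : R, 0 < nu -> exists C1 : R,
  forall (D : nat) (amin amax : nat)
    (rho : probability (borelV R D) R) (M : set 'rV[R]_D)
    (T : cell_family R D) (s : R) (n : nat)
    (dO : measure_display) (Omega : measurableType dO)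
    (P : probability Omega R) (X : 'I_n -> {RV P >-> borelV R D})
    (jstar : int)
    (c0 : 'I_(ncells T jstar) -> 'rV[R]_D)
    (Vhat : Omega -> 'I_(ncells T jstar) -> 'M[R]_(d, D)),
  (d <= D)%N ->
  measurable (M : set (borelV R D)) -> rho M = 1%E ->
  multiscale_tree d theta1 theta2 theta3 theta4 amin amax rho M T ->
  (2 <= n)%N ->
  iid_samples rho X ->
  1 <= s ->
  (As_norm d theta1 theta2 theta3 theta4 amin amax s rho M < +oo)%E ->
  jmin T <= jstar ->
  2 ^ (- jstar) = mu * scale_rate d n s ->
  (forall k, cell k (c0 k) /\
    enorm (c0 k - cond_mean rho (cell k)) <= theta2 * 2 ^ (- jstar)) ->
  (forall w k, emp_topspace (fun i => X i w) (cell k) (c0 k) (Vhat w k)) ->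
  ((P^*)%mu [set w |
      ((((fine (As_norm d theta1 theta2 theta3 theta4 amin amax s rho M))
          * mu `^ s + C1) * error_rate d n s)%:E
       <= L2err rho M
            (emp_gmra_proj (fun i => X i w) c0 (Vhat w)))%E]
    <= (C2 * n%:R `^ (- nu))%:E)%E.
Proof.
have [/andP[h40 h41]] := (h4, tt).
(* Each cell fails with probability at most $6n^{-\nu-1}$, and there are at most
   $(\mu\,sc)^{-d}/\theta_1$ cells, where $sc^{-d}\le n/\log n\le n/\log2$ for the rate $sc$ of the
   scale. *)
exists (6 / (mu ^+ d * theta1 * ln 2)) => nu nu0.
(* Makes the tail $n^{-\nu-1}$; the extra $1/n$ pays for the union bound. *)
pose K := 12 * (nu + 1).
have K0 : 0 < K by rewrite mulr_gt0 // addr_gt0.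
have dR : 0 < d%:R :> R by rewrite ltr0n.
(* The value of $r^2/\delta$, which is the same at all scales. *)
pose kap := theta2 ^+ 2 * d%:R / ((1 - theta4) * theta3).
pose H := ((4 + 16 * kap) ^+ 2 + 36) * K.
have H0 : 0 <= H.
  by rewrite mulr_ge0 ?(ltW K0) // addr_ge0 ?sqr_ge0.
pose b0 := Num.sqrt (H * theta2 ^+ 2 * mu ^+ 2 / (theta1 * mu ^+ d)).
have mud : 0 < mu ^+ d by rewrite exprn_gt0.
(* Of the 3 units, one absorbs the slack in the model-class norm, one makes the variance bound
   positive for [L2err_triangle], and one makes the final comparison strict. *)
exists (b0 + 3) => D amin amax rho M T s n dO Omega P X j c0 Vhat.
move=> dD mM rhoM hT n2 iid s1 Aoo jj hj hc0 hV.
have [wf [A1 A2 A3 A4 A5]] := hT.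
set A := As_norm _ _ _ _ _ _ _ _ _ _ in Aoo *.
have [fA0 hA] := As_norm_L2err hT Aoo; rewrite -/A in fA0 hA.
have sc0 : 0 < scale_rate d n s by exact: scale_rate_gt0.
have er0 : 0 < error_rate d n s by exact: error_rate_gt0.
have scd : ln n%:R / n%:R <= scale_rate d n s ^+ d by exact: ln_ratio_le_scale.
have scs : scale_rate d n s `^ s <= error_rate d n s by exact: scale_powR_le_error.
have scid : ln n%:R / n%:R * scale_rate d n s ^+ 2 =
    error_rate d n s ^+ 2 * scale_rate d n s ^+ d by exact: scale_error_identity.
set sc := scale_rate d n s in sc0 scd scs scid hj.
set er := error_rate d n s in er0 scs scid *.
have n0 : (0 < n)%N by apply: ltn_trans n2.
have nR : 0 < n%:R :> R by rewrite ltr0n.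
have L0 : 0 < ln n%:R :> R by exact: ln_nat_gt0.
set L : R := ln n%:R in L0 scd scid.
have rj0 : 0 < mu * sc by rewrite mulr_gt0.
pose r := theta2 * (mu * sc).
have r0 : 0 < r by rewrite mulr_gt0.
pose delta := (1 - theta4) * theta3 * (mu * sc) ^+ 2 / d%:R.
have t41 : 0 < 1 - theta4 by rewrite subr_gt0.
have del0 : 0 < delta by rewrite divr_gt0 // !mulr_gt0 // exprn_gt0.
have kapE : r ^+ 2 / delta = kap.
  by rewrite /r /delta /kap; field; rewrite !gt_eqF.
have mcell k : measurable (cell (c := T) (j := j) k : set (borelV R D)).
  by have [_ wfj] := wf; have [] := wfj j k jj.
have rhoC k : (0 < rho (cell (c := T) (j := j) k))%E.
  by have [_ wfj] := wf; have [] := wfj j k jj.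
have ball k : {ae rho, forall x, cell (c := T) (j := j) k x ->
    enorm ((x : 'rV[R]_D) - cond_mean rho (cell (c := T) (j := j) k)) <= r}.
  by have := A4 j k jj; rewrite hj.
have gap k : 0 < delta <= (eigvals (cond_cov rho (cell (c := T) (j := j) k)))`_d.-1 -
    (eigvals (cond_cov rho (cell (c := T) (j := j) k)))`_d.
  (* (A5) gives $\lambda_d-\lambda_{d+1}\ge(1-\theta_4)\lambda_d\ge\delta$. *)
  have [a1 a2] := A5 j k jj; rewrite del0 /=.
  have E : (2 : R) ^ (- (2 * j)) = (mu * sc) ^+ 2.
    by rewrite -hj exprnP exprz_exp mulNr mulrC.
  rewrite E in a1; set l1 := _`_(d.-1) in a1 a2 *; set l2 := _`_d in a2 *.
  have -> : delta = (1 - theta4) * (theta3 * (mu * sc) ^+ 2 / d%:R).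
    by rewrite /delta; ring.
  apply: (@le_trans _ _ ((1 - theta4) * l1)); last by lra.
  by rewrite ler_wpM2l // ltW.
have /choice[B hB] : forall k : 'I_(ncells T j), exists B : set Omega, _ :=
  fun k => cell_error iid (mcell k) r0 K0 (rhoC k) (ball k) hd dD n2 (gap k).
have mB k : measurable (B k) by have [] := hB k.
have cells_le : (ncells T j)%:R <= (mu ^+ d * sc ^+ d)^-1 / theta1.
  apply: le_trans (A3 j jj) _.
  rewrite -exprMn -hj exprnP exprz_exp invr_expz mulNr opprK //.
pose Bad := \bigcup_(k in [set: 'I_(ncells T j)]) B k.
have mBad : measurable Bad by exact: fin_bigcup_measurable.
have PBad : (P Bad <= (6 / (mu ^+ d * theta1 * ln 2) * n%:R `^ (- nu))%:E)%E.
  apply: le_trans (union_bound P mB) _.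
  apply: (@le_trans _ _ (\sum_(k < ncells T j) (6 * (n%:R `^ (- nu) / n%:R))%:E)%E).
    apply: lee_sum => k _; have [_ h _] := hB k; apply: le_trans h _.
    rewrite lee_fin -gaussian_tail_nat // /K.
    suff -> : 12 * (nu + 1) / 12 = nu + 1 by [].
    by field.
  rewrite sumEFin lee_fin sumr_const card_ord -(mulr_natl _ (ncells T j)).
  have N0 : 0 < n%:R `^ (- nu) :> R by rewrite powR_gt0.
  apply: (@le_trans _ _ ((mu ^+ d * sc ^+ d)^-1 / theta1 * (6 * (n%:R `^ (- nu) / n%:R)))).
    by rewrite ler_wpM2r // mulr_ge0 // divr_ge0 // ltW.
  have ln20 : 0 < ln 2 :> R by exact: ln_nat_gt0.
  have lnle : ln 2 <= L by rewrite ler_ln ?posrE // ler_nat.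
  have scd0 : 0 < sc ^+ d by rewrite exprn_gt0.
  have inv_le : (sc ^+ d)^-1 / n%:R <= (ln 2)^-1.
    rewrite -invfM lef_pV2 ?posrE ?mulr_gt0 //.
    by apply: (le_trans lnle); rewrite -ler_pdivrMr.
  have -> : (mu ^+ d * sc ^+ d)^-1 / theta1 * (6 * (n%:R `^ (- nu) / n%:R)) =
     6 / (mu ^+ d * theta1) * n%:R `^ (- nu) * ((sc ^+ d)^-1 / n%:R).
    by field; rewrite !gt_eqF.
  have -> : 6 / (mu ^+ d * theta1 * ln 2) * n%:R `^ (- nu) =
     6 / (mu ^+ d * theta1) * n%:R `^ (- nu) * (ln 2)^-1.
    by field; rewrite !gt_eqF.
  rewrite ler_wpM2l // mulr_ge0 ?(ltW N0) // divr_ge0 // ltW //.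
  by rewrite mulr_gt0.
(* By monotonicity of the outer measure it suffices that the error event lies in the measurable
   event [Bad], whatever the measurability of [Vhat]. *)
apply: le_trans PBad; rewrite -(measurable_mu_extE P mBad).
apply: le_mu_ext => w /= hw; apply: contrapT => nBad.
have good k : exists b : R, [/\ 0 <= b,
    (forall x, cell_core (rho := rho) (cell (c := T) (j := j) k) r x ->
      enorm (affproj (cond_mean rho (cell (c := T) (j := j) k))
               (cond_topspace d rho (cell (c := T) (j := j) k)) x -
             affproj (emp_mean (fun i => X i w) (cell k) (c0 k)) (Vhat w k) x) <= b) &
    b ^+ 2 * fine (rho (cell (c := T) (j := j) k)) <= H * r ^+ 2 * (L / n%:R)].
  have [_ _ h] := hB k; rewrite kapE in h; apply: (h w) => //.
    by move=> Bk; apply: nBad; exists k.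
  by have [_] := hc0 k; rewrite hj.
have /choice[be hbe] := good.
pose Q := gmra_proj d rho T j.
pose Q' := emp_gmra_proj (fun i => X i w) c0 (Vhat w).
pose f k (x : borelV R D) : 'rV[R]_D :=
  affproj (cond_mean rho (cell (c := T) (j := j) k))
          (cond_topspace d rho (cell (c := T) (j := j) k)) x -
  affproj (emp_mean (fun i => X i w) (cell k) (c0 k)) (Vhat w k) x.
have QQ' (x : 'rV[R]_D) : Q x - Q' x = \sum_k \1_(cell (c := T) (j := j) k) x *: f k x.
  rewrite /Q /Q' /gmra_proj /emp_gmra_proj /piecewise_affproj -sumrB.
  by apply: eq_bigr => k _; rewrite -scalerBr.
have mQ i : measurable_fun setT (fun x : borelV R D => (Q x) ord0 i).
  exact: measurable_piecewise_affproj.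
have mQ' i : measurable_fun setT (fun x : borelV R D => (Q' x) ord0 i).
  exact: measurable_piecewise_affproj.
have b00 : 0 <= b0 by exact: sqrtr_ge0.
have hint : (\int[rho]_(x in M) (enorm (Q x - Q' x) ^+ 2)%:E <=
    (((b0 + 1) * er) ^+ 2)%:E)%E.
  under eq_integral do rewrite QQ'.
  apply: (le_trans (integral_cells_le (E := fun k => cell_core (rho := rho) (cell k) r)
    (B := be) mM mcell _ _ _ _ _)).
  - by move=> k; exact: measurable_cell_core.
  - by move=> k; exact: rho_cell_core.
  - by move=> k l kl; exact: (same_scale_disjoint mM wf A1 A2).
  - move=> i; have -> : (fun x : borelV R D =>
        (\sum_k \1_(cell (c := T) (j := j) k) x *: f k x) ord0 i) =
        (fun x => Q x ord0 i - Q' x ord0 i).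
      by apply/funext => x; rewrite -QQ' !mxE.
    exact: measurable_funB.
  - by move=> k x; have [_ + _] := hbe k; apply.
  rewrite lee_fin; apply: (@le_trans _ _ (\sum_(k < ncells T j) H * r ^+ 2 * (L / n%:R))).
    by apply: ler_sum => k _; have [] := hbe k.
  rewrite sumr_const card_ord -(mulr_natl _ (ncells T j)).
  have Lq0 : 0 < L / n%:R by rewrite divr_gt0.
  apply: (@le_trans _ _ ((mu ^+ d * sc ^+ d)^-1 / theta1 * (H * r ^+ 2 * (L / n%:R)))).
    by rewrite ler_wpM2r // mulr_ge0 ?(ltW Lq0) // mulr_ge0 ?sqr_ge0.
  have scd0 : 0 < sc ^+ d by rewrite exprn_gt0.
  have -> : (mu ^+ d * sc ^+ d)^-1 / theta1 * (H * r ^+ 2 * (L / n%:R)) =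
      H * theta2 ^+ 2 * mu ^+ 2 / (theta1 * mu ^+ d) *
      ((L / n%:R * sc ^+ 2) / sc ^+ d).
    by rewrite /r; field; rewrite !gt_eqF.
  (* The balance identity turns the summed variance into a multiple of [er ^+ 2]. *)
  rewrite scid mulfK ?gt_eqF // exprMn ler_wpM2r ?sqr_ge0 //.
  have -> : H * theta2 ^+ 2 * mu ^+ 2 / (theta1 * mu ^+ d) = b0 ^+ 2.
    rewrite sqr_sqrtr //; apply: divr_ge0; last exact: mulr_ge0 (ltW h1) (ltW mud).
    by rewrite mulr_ge0 ?sqr_ge0 // mulr_ge0 ?sqr_ge0.
  by rewrite ler_pXn2r ?nnegrE ?addr_ge0 // lerDl.
have mus0 : 0 < mu `^ s by rewrite powR_gt0.
have hQ : (L2err rho M Q <= ((fine A * mu `^ s + 1) * er)%:E)%E.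
  (* The slack $\mu^{-s}$ becomes 1 after multiplication by $\mu^s$. *)
  apply: le_trans (hA (mu `^ s)^-1 j _ jj) _; first by rewrite invr_gt0.
  have -> : 2 `^ (- (j%:~R * s)) = mu `^ s * sc `^ s.
    rewrite -powRM ?(ltW hmu) ?(ltW sc0) // -hj -mulNr powRrM -mulrNz.
    by rewrite powR_intmul.
  rewrite lee_fin mulrA mulrDl mulVf ?gt_eqF //.
  by rewrite ler_wpM2l // addr_ge0 // mulr_ge0 // ltW.
have a0 : 0 < (fine A * mu `^ s + 1) * er.
  by rewrite mulr_gt0 // ltr_wpDl // mulr_ge0 // ltW.
have bb0 : 0 < (b0 + 1) * er by rewrite mulr_gt0 // ltr_wpDl.
have := le_trans hw (L2err_triangle mM mQ mQ' a0 bb0 hQ hint).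
by rewrite lee_fin -mulrDl ler_pM2r //; lra.
Qed.
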